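(* Let $\mathbb{F}$ be a perfect field, $k\ge2$, and let $T\in V_1\otimes\cdots\otimes V_k$ be a $k$-tensor over $\mathbb{F}$ with slicing $\bar T\colon V_1\times\cdots\times V_{k-1}\to V_k$, viewed via fixed bases as a polynomial map $\bar T\colon\mathbb{F}^n\to\mathbb{F}^m$. Let $X\subseteq\ker\bar T$ be an irreducible variety defined over $\mathbb{F}$ that has an $\mathbb{F}$-rational point which is neither singular nor $D\bar T$-singular. Then $$\mathrm{PR}(T)\le(2^{k-1}-1)\operatorname{codim}X.$$
   Context: Partition rank $\mathrm{PR}(T)$ over $\mathbb{F}$: the smallest $r$ such that $T$ (as a $k$-linear form) is a sum of $r$ products $p\cdot q$ with $p,q$ multilinear forms over $\mathbb{F}$ in the variables indexed by complementary nonempty subsets $S,S'$ of $[k]$. The slicing $\bar T$ is the $(k-1)$-linear map whose coordinates are the slices of $T$ along the last axis; $\ker\bar T=\{x\in\overline{\mathbb{F}}^n:\bar T(x)=0\}$. A variety is defined over $\mathbb{F}$ if cut out by polynomials with coefficients in $\mathbb{F}$; an $\mathbb{F}$-rational point is a point with coordinates in $\mathbb{F}$; $\operatorname{codim}X=n-\dim X$. $D\bar T(x)\in\mathbb{F}^m\otimes\mathbb{F}^n$ is the Jacobian matrix $(\partial_j\bar T_i(x))$. For $g$ in the ideal $I(X)$ of polynomials over $\overline{\mathbb{F}}$ vanishing on $X$, the tangent space is $\mathbf{T}_xX=\{v:(Dg(x))v=0\ \forall g\in I(X)\}$; a point $x\in X$ is non-singular if $\dim\mathbf{T}_xX=\dim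 X$ and singular otherwise. For a polynomial matrix $f$, a point $x\in X$ is $f$-singular if $\operatorname{rank}f(x)<\max_{y\in X}\operatorname{rank}f(y)$. *)

(* Defs.v *)
From HB Require Import structures.
From mathcomp Require Import all_boot all_order all_algebra.
From mathcomp Require Import mpoly.
Set Implicit Arguments. Unset Strict Implicit. Unset Printing Implicit Defensive.
Import Order.TTheory GRing.Theory.
Local Open Scope ring_scope.

Definition perfect_field (F : fieldType) : Prop :=
  forall p : nat, p \in [pchar F] -> forall a : F, exists b : F, b ^+ p = a.

Definition is_alg_closure (F : fieldType) (K : closedFieldType)
  (iota : {rmorphism F -> K}) : Prop :=
  forall z : K, exists q : {poly F}, q != 0 /\ root (map_poly iota q) z.

(* A k-tensor in F^{d 0} (x) ... (x) F^{d (k-1)} is given (via the fixed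
   bases) by its coefficient array, a function on multi-indices. *)
Definition tidx (k : nat) (d : nat -> nat) : finType :=
  {dffun forall j : 'I_k, 'I_(d j)}.

(* a function of multi-indices depending only on the coordinates in S,
   i.e. a multilinear form in the variables indexed by S *)
Definition depends_only (k : nat) (d : nat -> nat) (R : Type)
  (S : {set 'I_k}) (f : tidx k d -> R) : Prop :=
  forall a b : tidx k d, (forall j, j \in S -> a j = b j) -> f a = f b.

Definition partition_decomp (F : fieldType) (k : nat) (d : nat -> nat)
  (T : tidx k d -> F) (r : nat) : Prop :=
  exists (S : 'I_r -> {set 'I_k}) (p q : 'I_r -> tidx k d -> F),
    [/\ forall t, S t != set0 /\ S t != setT,
        forall t, depends_only (S t) (p t),
        forall t, depends_only (~: S t) (q t) &
        forall a, T a = \sum_(t < r) p t a * q t a].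

Definition partition_rank_le (F : fieldType) (k : nat) (d : nat -> nat)
  (T : tidx k d -> F) (B : nat) : Prop :=
  exists2 r, (r <= B)%N & partition_decomp T r.

Definition nvars (k : nat) (d : nat -> nat) : nat := \sum_(j < k.-1) d j.
Definition nout (k : nat) (d : nat -> nat) : nat := d k.-1.

(* the variable with flat index p (block j of V_j occupies the positions
   d 0 + ... + d (j-1) + i, i < d j) *)
Definition var (K : fieldType) (n p : nat) : {mpoly K[n]} :=
  if @insub nat (fun x => x < n)%N _ p is Some i then 'X_i else 0.

Definition offset (d : nat -> nat) (j : nat) : nat := \sum_(l < j) d l.

Definition slicing (F : fieldType) (K : fieldType) (iota : F -> K)
  (k : nat) (d : nat -> nat) (T : tidx k d -> F) (c : 'I_(nout k d))
  : {mpoly K[nvars k d]} :=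
  \sum_(a : tidx k d | [forall j : 'I_k, (val j == k.-1) ==> (val (a j) == val c)])
     (iota (T a))%:MP *
     \prod_(j : 'I_k | val j != k.-1) var K (nvars k d) (offset d j + a j).

Definition jacobian (F K : fieldType) (iota : F -> K) (k : nat) (d : nat -> nat)
  (T : tidx k d -> F) (x : 'I_(nvars k d) -> K) : 'M[K]_(nout k d, nvars k d) :=
  \matrix_(c, j) (mderiv j (slicing iota T c)).@[x].

Definition zero_set (K : fieldType) (n : nat) (P : {mpoly K[n]} -> Prop)
  : ('I_n -> K) -> Prop := fun x => forall g, P g -> g.@[x] = 0.

Definition same_set (A : Type) (X Y : A -> Prop) := forall x, X x <-> Y x.

Definition zclosed (K : fieldType) (n : nat) (X : ('I_n -> K) -> Prop) :=
  exists P : {mpoly K[n]} -> Prop, same_set X (zero_set P).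

Definition irreducible_var (K : fieldType) (n : nat) (X : ('I_n -> K) -> Prop) :=
  [/\ zclosed X, exists x, X x &
      forall Y Z : ('I_n -> K) -> Prop, zclosed Y -> zclosed Z ->
        same_set X (fun x => Y x \/ Z x) -> same_set X Y \/ same_set X Z].

Definition defined_over (F : fieldType) (K : fieldType) (iota : {rmorphism F -> K})
  (n : nat) (X : ('I_n -> K) -> Prop) :=
  exists P : {mpoly K[n]} -> Prop,
    (forall g, P g -> exists h : {mpoly F[n]}, g = map_mpoly iota h) /\
    same_set X (zero_set P).

Definition rational_point (F K : fieldType) (iota : F -> K) (n : nat)
  (x : 'I_n -> K) := exists a : 'I_n -> F, forall i, x i = iota (a i).

Definition strict_subset (A : Type) (X Y : A -> Prop) :=
  (forall x, X x -> Y x) /\ exists y, Y y /\ ~ X y.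

Definition has_chain (K : fieldType) (n : nat) (X : ('I_n -> K) -> Prop) (r : nat) :=
  exists C : nat -> ('I_n -> K) -> Prop,
    [/\ forall i, (i <= r)%N -> irreducible_var (C i),
        forall i, (i < r)%N -> strict_subset (C i) (C i.+1) &
        same_set (C r) X].

Definition var_dim (K : fieldType) (n : nat) (X : ('I_n -> K) -> Prop) (r : nat) :=
  has_chain X r /\ ~ has_chain X r.+1.

Definition vanishing_ideal (K : fieldType) (n : nat) (X : ('I_n -> K) -> Prop)
  (g : {mpoly K[n]}) := forall x, X x -> g.@[x] = 0.

Definition tangent_space (K : fieldType) (n : nat) (X : ('I_n -> K) -> Prop)
  (x : 'I_n -> K) (v : 'I_n -> K) : Prop :=
  forall g, vanishing_ideal X g -> \sum_(j < n) (mderiv j g).@[x] * v j = 0.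

Definition has_indep (K : fieldType) (n : nat) (V : ('I_n -> K) -> Prop) (r : nat) :=
  exists vs : 'I_r -> 'I_n -> K,
    (forall i, V (vs i)) /\
    (forall c : 'I_r -> K, (forall j, \sum_(i < r) c i * vs i j = 0) ->
       forall i, c i = 0).

Definition subspace_dim (K : fieldType) (n : nat) (V : ('I_n -> K) -> Prop) (r : nat) :=
  has_indep V r /\ ~ has_indep V r.+1.

(* Main.v *)
Require Import Defs.
From HB Require Import structures.
From mathcomp Require Import all_boot all_order all_algebra.
From mathcomp Require Import mpoly.
From mathcomp Require Import ring zify.
From Stdlib Require Import Classical IndefiniteDescription FunctionalExtensionality.
Import GRing.Theory.
Local Open Scope ring_scope.
Set Implicit Arguments.
Unset Strict Implicit.
Unset Printing Implicit Defensive.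

(* If [delta E - sum_t p_t q_t] vanishes on [X], then on tangent vectors at points of [X]
   so does its differential, and the missing normal directions are covered by
   [c = codim X] further products, [c] being the rank of the conormal space at
   [x0].  Starting from [Tbar = 0] on [X] (no terms), each differentiation thus turns
   [r] terms into [2 r + c], so the [(k-1)]-st mixed derivative of [Tbar], which is
   [T], has [(2^(k-1) - 1) c] terms; the coefficients are rational functions regular
   at [x0], and one evaluates there.

   Two facts make this work over [F].  First, at every point of [X] the
   differentials of [I(X)] have rank at most [codim X]: with [s] a maximal algebraically
   independent set of coordinates, [I(X)] is generically generated by one relation
   for each of the other coordinates, and a chain of length [r] forces [|s| >= r].
   Second, [I(X)] is spanned by polynomials over [F]: it is stable under the
   (partial) [F]-automorphisms of [K], whose fixed elements lie in [F] since [F] is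
   perfect. *)

(** * Algebraic elements modulo a prime ideal *)

Record prime_ideal (R : comNzRingType) (I : R -> Prop) : Prop := PrimeIdeal {
  prime0 : I 0;
  primeD : forall a b, I a -> I b -> I (a + b);
  primeMl : forall r a, I a -> I (r * a);
  prime1 : ~ I 1;
  primeP : forall a b, I (a * b) -> I a \/ I b }.

(** [emb] need not be injective: [dom] presents a subring of [R] by a formal domain, over which
    pseudo-division is available. *)
Record extension (R : comNzRingType) := Extension {
  dom : idomainType;
  emb : {rmorphism dom -> R} }.

Definition adjoin (R : comNzRingType) (E : extension R) (x : R) : extension R :=
  Extension (horner_eval x \o map_poly (emb E) : {rmorphism {poly dom E} -> R}).

Lemma adjoinE (R : comNzRingType) (E : extension R) (x : R) (p : {poly dom E}) :
  emb (adjoin E x) p = (map_poly (emb E) p).[x].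
Proof. by []. Qed.

Lemma adjoinC (R : comNzRingType) (E : extension R) (x : R) (c : dom E) :
  emb (adjoin E x) c%:P = emb E c.
Proof. by rewrite adjoinE map_polyC hornerC. Qed.

Lemma adjoinX (R : comNzRingType) (E : extension R) (x : R) :
  emb (adjoin E x) ('X : {poly dom E}) = x.
Proof. by rewrite adjoinE map_polyX hornerX. Qed.

(** A leading coefficient outside [I] keeps the relation nontrivial over the fraction field of the
    image of [E] in [R/I]. *)
Definition algebraic_mod (R : comNzRingType) (I : R -> Prop) (E : extension R)
    (x : R) : Prop :=
  exists p : {poly dom E}, ~ I (emb E (lead_coef p)) /\ I (emb (adjoin E x) p).

Fixpoint in_span (R : comNzRingType) (Ps : seq R) (u : R) : Prop :=
  if Ps is P :: Ps' then exists h, in_span Ps' (u - h * P) else u = 0.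

Lemma in_span0 (R : comNzRingType) (Ps : seq R) : in_span Ps 0.
Proof. by elim: Ps => //= P Ps IH; exists 0; rewrite mul0r subr0. Qed.

Lemma in_spanD (R : comNzRingType) (Ps : seq R) (u v : R) :
  in_span Ps u -> in_span Ps v -> in_span Ps (u + v).
Proof.
elim: Ps u v => /= [u v -> ->|P Ps IH u v [h hu] [g gv]]; first by rewrite addr0.
by exists (h + g); have := IH _ _ hu gv; congr in_span; ring.
Qed.

Lemma in_spanM (R : comNzRingType) (Ps : seq R) (a u : R) :
  in_span Ps u -> in_span Ps (a * u).
Proof.
elim: Ps u => /= [u ->|P Ps IH u [h hu]]; first by rewrite mulr0.
by exists (a * h); have := IH _ hu; congr in_span; ring.
Qed.

Section PrimeIdeal.
Variables (R : comNzRingType) (I : R -> Prop).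
Hypothesis primeI : prime_ideal I.

Lemma primeN a : I a -> I (- a).
Proof. by rewrite -mulN1r; exact: primeMl. Qed.

Lemma primeB a b : I a -> I b -> I (a - b).
Proof. by move=> Ia Ib; apply: primeD => //; apply: primeN. Qed.

Lemma primeMr a r : I a -> I (a * r).
Proof. by rewrite mulrC; exact: primeMl. Qed.

Lemma prime_sum (J : Type) (s : seq J) (P : pred J) (f : J -> R) :
  (forall i, P i -> I (f i)) -> I (\sum_(i <- s | P i) f i).
Proof. by move=> If; apply: big_ind => //; [exact: prime0 | exact: primeD]. Qed.

Lemma nprimeM a b : ~ I a -> ~ I b -> ~ I (a * b).
Proof. by move=> nIa nIb /(primeP primeI) []. Qed.

Lemma nprimeX a m : ~ I a -> ~ I (a ^+ m).
Proof.
move=> nIa; elim: m => [|m IH]; first exact: prime1.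
by rewrite exprS; exact: nprimeM.
Qed.

Lemma nprime_neq0 (E : extension R) (d : dom E) : ~ I (emb E d) -> d != 0.
Proof.
by move=> nId; apply/eqP => d0; apply: nId; rewrite d0 rmorph0; exact: prime0.
Qed.

Lemma lead_strip (D : nzRingType) (p : {poly D}) :
  p = take_poly (size p).-1 p + (lead_coef p)%:P * 'X^((size p).-1).
Proof.
apply/polyP => i; rewrite coefD coef_take_poly coefCM coefXn lead_coefE.
case: ltngtP => [_|lti|->]; rewrite ?mulr0 ?mulr1 ?addr0 ?add0r //.
by rewrite nth_default // (leq_trans (leqSpred _)).
Qed.

(** Leading terms with coefficient in [I] do not affect the class modulo [I] and are dropped one by
    one. *)
Lemma exists_stripped (E : extension R) x (p : {poly dom E}) :
  ~ I (emb (adjoin E x) p) ->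
  exists q : {poly dom E}, [/\ (size q <= size p)%N, ~ I (emb E (lead_coef q)) &
    I (emb (adjoin E x) p - emb (adjoin E x) q)].
Proof.
have [m] := ubnP (size p); elim: m p => // m IH p szp nIp.
case: (classic (I (emb E (lead_coef p)))) => [Il|nIl]; last first.
  by exists p; rewrite subrr; split=> //; exact: prime0.
have p0 : p != 0.
  by apply/eqP => p0; apply: nIp; rewrite p0 rmorph0; exact: prime0.
have szp0 : (0 < size p)%N by rewrite size_poly_gt0.
set t := take_poly (size p).-1 p.
have szt : (size t <= (size p).-1)%N by exact: size_take_poly.
have Idiff : I (emb (adjoin E x) p - emb (adjoin E x) t).
  rewrite {1}[p]lead_strip rmorphD addrC addKr rmorphM adjoinC.
  exact: primeMr.
have [||q [szq nIq Iq]] := IH t.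
- by rewrite (leq_ltn_trans szt) // -ltnS prednK.
- by move=> It; apply: nIp; rewrite -[X in I X](subrK (emb (adjoin E x) t)); exact: primeD.
exists q; split=> //; first by rewrite (leq_trans szq) // (leq_trans szt) // leq_pred.
by have := primeD primeI Idiff Iq; rewrite addrA subrK.
Qed.

(** Takes the place of the minimal polynomial over the fraction field of the quotient. By minimality
    a shorter relation has its leading coefficient in [I]; removing that term and repeating puts all
    its coefficients in [I]. *)
Lemma exists_minimal (E : extension R) x : algebraic_mod I E x ->
  exists f : {poly dom E}, [/\ ~ I (emb E (lead_coef f)), I (emb (adjoin E x) f) &
    forall p : {poly dom E}, (size p < size f)%N -> I (emb (adjoin E x) p) ->
      forall i, I (emb E p`_i)].
Proof.
case=> f0 [lf0 If0]; have [m] := ubnP (size f0).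
elim: m f0 lf0 If0 => // m IH f lf If szf.
case: (classic (exists p : {poly dom E}, [/\ (size p < size f)%N,
    ~ I (emb E (lead_coef p)) & I (emb (adjoin E x) p)])) => [[p [szp lp Ip]]|nex].
  by apply: IH lp Ip _; apply: leq_trans szp szf.
exists f; split=> // p; have [k] := ubnP (size p).
elim: k p => // k IHk p szpk szp Ip i.
have Il : I (emb E (lead_coef p)).
  by apply: NNPP => nIl; apply: nex; exists p.
have [->|p0] := eqVneq p 0; first by rewrite coef0 rmorph0; exact: prime0.
have szp0 : (0 < size p)%N by rewrite size_poly_gt0.
set t := take_poly (size p).-1 p.
have szt : (size t < size p)%N by rewrite -[X in (_ < X)%N]prednK // ltnS size_take_poly.
have It : I (emb (adjoin E x) t).
  have -> : t = p - (lead_coef p)%:P * 'X^((size p).-1).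
    by apply/eqP; rewrite -subr_eq opprK -lead_strip.
  by rewrite rmorphB rmorphM adjoinC; apply: primeB => //; apply: primeMr.
rewrite [p]lead_strip coefD rmorphD coefCM coefXn rmorphM.
apply: primeD => //; last exact: primeMr.
by apply: IHk => //; [exact: leq_trans szt _|exact: ltn_trans szt szp].
Qed.

(* Euclid's algorithm against the minimal relation [f] of [x]: a multiple of
   [emb (adjoin E x) q] descends to [E] modulo [I]. *)
Lemma multiple_descends_lead (E : extension R) x (q : {poly dom E}) :
  algebraic_mod I E x -> ~ I (emb E (lead_coef q)) -> ~ I (emb (adjoin E x) q) ->
  exists (d : dom E) (a : R), ~ I (emb E d) /\ I (a * emb (adjoin E x) q - emb E d).
Proof.
move=> /exists_minimal [f [lf If minf]].
have [m] := ubnP (size q); elim: m q => // m IH q szm lq nIq.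
have q0 : q != 0 by apply: contra_not_neq lq => ->; rewrite lead_coef0 rmorph0; exact: prime0.
have f0 : f != 0 by apply: contra_not_neq lf => ->; rewrite lead_coef0 rmorph0; exact: prime0.
have step (r : {poly dom E}) b : (size r < size q)%N -> ~ I (emb (adjoin E x) r) ->
    I (b * emb (adjoin E x) q - emb (adjoin E x) r) ->
    exists (d : dom E) (a : R), ~ I (emb E d) /\ I (a * emb (adjoin E x) q - emb E d).
  move=> szr nIr Ib; have [r' [szr' lr' Ir']] := exists_stripped nIr.
  have [|||d [a [nId Iad]]] := IH r' => //.
  - by rewrite (leq_ltn_trans szr') // (leq_trans szr).
  - move=> Ir'0; apply: nIr.
    by rewrite -[X in I X](subrK (emb (adjoin E x) r')); exact: primeD.
  exists d, (a * b); split=> //.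
  have -> : a * b * emb (adjoin E x) q - emb E d =
    a * (b * emb (adjoin E x) q - emb (adjoin E x) r)
    + (a * (emb (adjoin E x) r - emb (adjoin E x) r')
    + (a * emb (adjoin E x) r' - emb E d)) by ring.
  by do !(apply: primeD => //); apply: primeMl.
(* The longer of [q] and [f] is pseudo-divided by the other; a constant [q] already lies in [E]. *)
have [szfq|szqf] := leqP (size f) (size q).
  have /(congr1 (emb (adjoin E x))) := Pdiv.Idomain.divp_eq q f.
  set e := scalp q f; set h := q %/ f; set r := q %% f.
  rewrite -mul_polyC rmorphD !rmorphM adjoinC rmorphXn => Eq.
  have Ir : I (emb E (lead_coef f) ^+ e * emb (adjoin E x) q - emb (adjoin E x) r).
    by rewrite Eq addrK; exact: primeMl.
  apply: (step _ _ _ _ Ir); first by rewrite (leq_trans _ szfq) // ltn_modp.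
  move=> Ir0; have := primeD primeI Ir Ir0; rewrite subrK.
  by apply: nprimeM => //; exact: nprimeX.
have [szq1|szq1] := leqP (size q) 1.
  exists (lead_coef q), 1; split=> //.
  have [c ->] : exists c, q = c%:P by exists q`_0; exact: size1_polyC.
  by rewrite mul1r adjoinC lead_coefC subrr; exact: prime0.
have Df := Pdiv.Idomain.divp_eq f q.
move: Df; set e := scalp f q; set h := f %/ q; set r := f %% q => Df.
have szr : (size r < size q)%N by rewrite ltn_modp.
have Er : emb (adjoin E x) r = emb E (lead_coef q) ^+ e * emb (adjoin E x) f
    - emb (adjoin E x) h * emb (adjoin E x) q.
  move/(congr1 (emb (adjoin E x))): Df.
  by rewrite -mul_polyC rmorphD !rmorphM adjoinC rmorphXn => ->; rewrite addrC addKr.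
case: (classic (I (emb (adjoin E x) r))) => [Ir|nIr]; last first.
  apply: (step r (- emb (adjoin E x) h)) => //.
  have -> : - emb (adjoin E x) h * emb (adjoin E x) q - emb (adjoin E x) r =
    - emb E (lead_coef q) ^+ e * emb (adjoin E x) f by rewrite Er; ring.
  exact: primeMl.
(* A remainder in [I] would factor [f] modulo [I] as [h * q] with [q] nonzero, forcing [h] into [I].
   Being shorter than [f], [h] would have all its coefficients in [I], and then so would the leading
   coefficient of [f]. *)
exfalso; have lqe0 : lead_coef q ^+ e != 0 by rewrite expf_neq0 // lead_coef_eq0.
have szf : size (h * q + r) = size f by rewrite -Df size_scale.
have h0 : h != 0.
  apply/eqP => h0; move: szf; rewrite h0 mul0r add0r => szf.
  by have := ltn_trans szr szqf; rewrite szf ltnn.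
have szhq : (size r < size (h * q)%R)%N.
  rewrite size_mul // (leq_trans szr) //.
  by rewrite -(prednK (_ : 0 < size h)%N) ?size_poly_gt0 // addSn leq_addl.
have Ih : I (emb (adjoin E x) h).
  case: (primeP primeI (a := emb (adjoin E x) h) (b := emb (adjoin E x) q)) => //.
  have -> : emb (adjoin E x) h * emb (adjoin E x) q =
    emb E (lead_coef q) ^+ e * emb (adjoin E x) f - emb (adjoin E x) r by rewrite Er; ring.
  by apply: primeB => //; apply: primeMl.
have szh : (size h < size f)%N.
  rewrite -szf size_polyDl // size_mul // -subn1.
  move: szq1 h0; rewrite -size_poly_gt0.
  by move: (size q) (size h) => b c; lia.
have := minf _ szh Ih (size h).-1; rewrite -lead_coefE => Il.
have : I (emb E (lead_coef q ^+ e * lead_coef f)).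
  rewrite -lead_coefZ Df lead_coefDl // lead_coefM rmorphM; exact: primeMr.
by rewrite rmorphM rmorphXn; apply: nprimeM => //; exact: nprimeX.
Qed.

Lemma multiple_descends (E : extension R) x (p : {poly dom E}) :
  algebraic_mod I E x -> ~ I (emb (adjoin E x) p) ->
  exists (d : dom E) (a : R), ~ I (emb E d) /\ I (a * emb (adjoin E x) p - emb E d).
Proof.
move=> algx nIp; have [q [_ lq Iq]] := exists_stripped nIp.
have [|d [a [nId Ia]]] := multiple_descends_lead algx lq.
  by move=> Iq0; apply: nIp; rewrite -[X in I X](subrK (emb (adjoin E x) q)); exact: primeD.
exists d, a; split=> //.
have -> : a * emb (adjoin E x) p - emb E d =
  a * (emb (adjoin E x) p - emb (adjoin E x) q) + (a * emb (adjoin E x) q - emb E d) by ring.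
by apply: primeD => //; apply: primeMl.
Qed.

(** Incomparability for algebraic extensions: an element outside [I] has a multiple congruent to
    some [d] of [E] outside [I], and [J] would contain that [d]. *)
Lemma contraction_adjoin (J : R -> Prop) (E : extension R) x :
  prime_ideal J -> (forall u, I u -> J u) -> algebraic_mod I E x ->
  (forall d, J (emb E d) -> I (emb E d)) ->
  forall p, J (emb (adjoin E x) p) -> I (emb (adjoin E x) p).
Proof.
move=> primeJ IJ algx JI p Jp; apply: NNPP => nIp.
have [d [a [nId Ia]]] := multiple_descends algx nIp; apply/nId/JI.
have -> : emb E d = a * emb (adjoin E x) p - (a * emb (adjoin E x) p - emb E d) by ring.
apply: primeD => //; first exact: primeMl.
by rewrite -mulN1r; apply: primeMl => //; exact: IJ.
Qed.

Definition generically_spans (Ps : seq R) (E : extension R) :=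
  forall d, I (emb E d) -> exists2 l, ~ I l & in_span Ps (l * emb E d).

(** Pseudo-division by the minimal relation [f] of [x] leaves a remainder whose coefficients lie in
    [I], where [Ps] already suffices; the value of [f] at [x] is the only new generator. *)
Lemma generically_spans_adjoin Ps (E : extension R) x :
  generically_spans Ps E -> algebraic_mod I E x ->
  exists2 P, I P & generically_spans (P :: Ps) (adjoin E x).
Proof.
move=> span_E /exists_minimal [f [lf If minf]].
exists (emb (adjoin E x) f) => // p Ip.
have f0 : f != 0 by apply: contra_not_neq lf => ->; rewrite lead_coef0 rmorph0; exact: prime0.
have /(congr1 (emb (adjoin E x))) := Pdiv.Idomain.divp_eq p f.
set e := scalp p f; set h := p %/ f; set r := p %% f.
rewrite -mul_polyC rmorphD !rmorphM adjoinC rmorphXn => Ep.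
have szr : (size r < size f)%N by rewrite ltn_modp.
have Ir : I (emb (adjoin E x) r).
  have -> : emb (adjoin E x) r = emb E (lead_coef f) ^+ e * emb (adjoin E x) p
    - emb (adjoin E x) h * emb (adjoin E x) f by rewrite Ep; ring.
  by apply: primeB; apply: primeMl.
have [l nIl spanl] : exists2 l, ~ I l & in_span Ps (l * emb (adjoin E x) r).
  have Ir_i := minf _ szr Ir.
  (* The multipliers of the individual coefficients are multiplied together, one coefficient at a
     time. *)
  rewrite adjoinE horner_coef; move: (size _) => N; elim: N => [|N [l nIl IH]].
    by exists 1; [exact: prime1|rewrite big_ord0 mulr0; exact: in_span0].
  have [l' nIl' spl'] := span_E _ (Ir_i N); exists (l * l'); first exact: nprimeM.
  rewrite big_ord_recr /= coef_map mulrDr; apply: in_spanD.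
    by rewrite -mulrA [l' * _]mulrC mulrA mulrC; exact: in_spanM.
  have -> : l * l' * (emb E r`_N * x ^+ N) = l * x ^+ N * (l' * emb E r`_N) by ring.
  exact: in_spanM.
exists (l * emb E (lead_coef f) ^+ e); first by apply: nprimeM => //; exact: nprimeX.
exists (l * emb (adjoin E x) h); rewrite -mulrA Ep.
by have -> : l * (emb (adjoin E x) h * emb (adjoin E x) f + emb (adjoin E x) r)
  - l * emb (adjoin E x) h * emb (adjoin E x) f = l * emb (adjoin E x) r by ring.
Qed.

Lemma algebraic_mod_adjoin (E : extension R) x y :
  algebraic_mod I E x -> algebraic_mod I (adjoin E y) x.
Proof.
case=> p [lp Ip]; exists (map_poly polyC p).
rewrite lead_coef_map_eq ?polyC_eq0 ?(nprime_neq0 lp) // adjoinC; split=> //; move: Ip.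
rewrite [in X in _ -> X]adjoinE -map_poly_comp adjoinE; congr (I _.[_]).
by apply: eq_map_poly => d; exact/esym/adjoinC.
Qed.

End PrimeIdeal.

(** * Transcendence bases made of coordinates *)

Section CoordinateTower.
Variables (K : fieldType) (n : nat).
Implicit Types (I J : {mpoly K[n]} -> Prop) (s t : seq 'I_n).

Definition constants : extension {mpoly K[n]} :=
  Extension (@mpolyC n K : {rmorphism K -> {mpoly K[n]}}).

Definition tower s : extension {mpoly K[n]} :=
  foldr (fun j E => adjoin E 'X_j) constants s.

Fixpoint independent I s : Prop :=
  if s is j :: s' then independent I s' /\ ~ algebraic_mod I (tower s') 'X_j
  else True.

Lemma constant_nprime I (c : K) : prime_ideal I -> I c%:MP -> c = 0.
Proof.
move=> primeI Ic; apply/eqP; apply: contra_notT (prime1 primeI) => c0.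
have := primeMl primeI (c^-1)%:MP Ic.
by rewrite -mpolyCM mulVf.
Qed.

(** A nonzero [d] has a nonzero leading coefficient, by induction outside [I]; so it would be an
    algebraic relation for the coordinate adjoined last. *)
Lemma independent_inj I s (d : dom (tower s)) :
  prime_ideal I -> independent I s -> I (emb (tower s) d) -> d = 0.
Proof.
move=> primeI; elim: s d => [|j s IH] /= d; first by move=> _; exact: constant_nprime.
case=> inds nalg Id; apply: NNPP => /eqP d0; apply: nalg; exists d; split=> // Il.
by move: d0; rewrite -lead_coef_eq0 (IH _ inds Il) eqxx.
Qed.

Lemma independent_sub I J s : prime_ideal I -> prime_ideal J ->
  (forall u, I u -> J u) -> independent J s -> independent I s.
Proof.
move=> primeI primeJ IJ; elim: s => //= j s IH [inds nalg]; split; first exact: IH.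
case=> p [lp Ip]; apply: nalg; exists p; split; last exact: IJ.
move=> Jl; apply: lp; rewrite (independent_inj primeJ inds Jl) rmorph0.
exact: prime0.
Qed.

Lemma tower_const s (c : K) : exists d, emb (tower s) d = c%:MP.
Proof.
elim: s => [|j s [d Ed]] /=; first by exists c.
by exists d%:P; exact: etrans (adjoinC _ d) Ed.
Qed.

Lemma tower_X s j : j \in s -> exists d, emb (tower s) d = 'X_j.
Proof.
elim: s => //= i s IH; rewrite inE; case: eqVneq => [-> _|_ /= /IH [d Ed]].
  by exists 'X; exact: adjoinX.
by exists d%:P; exact: etrans (adjoinC _ d) Ed.
Qed.

Lemma tower_full s (u : {mpoly K[n]}) :
  (forall j, j \in s) -> exists d, emb (tower s) d = u.
Proof.
move=> full; rewrite (mpolyE u).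
apply: (big_ind (fun v => exists d, emb (tower s) d = v)).
- by exists 0; rewrite rmorph0.
- by move=> _ _ [d <-] [e <-]; exists (d + e); rewrite rmorphD.
move=> m _; have [c Ec] := tower_const s u@_m.
rewrite mpolyXE_id.
have [d Ed] : exists d, emb (tower s) d = \prod_(i < n) 'X_i ^+ m i.
  apply: (big_ind (fun v => exists d, emb (tower s) d = v)).
  - by exists 1; rewrite rmorph1.
  - by move=> _ _ [d <-] [e <-]; exists (d * e); rewrite rmorphM.
  by move=> i _; have [d <-] := tower_X (full i); exists (d ^+ m i); rewrite rmorphXn.
by exists (c * d); rewrite rmorphM Ec Ed mul_mpolyC.
Qed.

Lemma algebraic_mod_im I (E : extension {mpoly K[n]}) (d : dom E) :
  prime_ideal I -> algebraic_mod I E (emb E d).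
Proof.
move=> primeI; exists ('X - d%:P); rewrite lead_coefXsubC rmorph1.
split; first exact: prime1.
by rewrite adjoinE rmorphB /= map_polyX map_polyC hornerXsubC subrr; exact: prime0.
Qed.

Lemma independent_uniq I s : prime_ideal I -> independent I s -> uniq s.
Proof.
move=> primeI; elim: s => //= j s IH [/IH -> nalg]; rewrite andbT.
by apply/negP => /tower_X [d Ed]; apply: nalg; rewrite -Ed; exact: algebraic_mod_im.
Qed.

Lemma independent_size I s : prime_ideal I -> independent I s -> (size s <= n)%N.
Proof.
move=> primeI /(independent_uniq primeI)/card_uniqP <-.
by rewrite -[X in (_ <= X)%N]card_ord max_card.
Qed.

Lemma algebraic_mod_cat I s t x : prime_ideal I ->
  algebraic_mod I (tower s) x -> algebraic_mod I (tower (t ++ s)) x.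
Proof. by move=> primeI algx; elim: t => //= j t; exact: algebraic_mod_adjoin. Qed.

Lemma exists_maximal_independent I s : prime_ideal I -> independent I s ->
  exists t, [/\ independent I t, (size s <= size t)%N &
    forall j, algebraic_mod I (tower t) 'X_j].
Proof.
move=> primeI; have [m] := ubnP (n - size s); elim: m s => // m IH s szs inds.
case: (classic (exists j, ~ algebraic_mod I (tower s) 'X_j)) => [[j nalg]|nex].
  have indjs : independent I (j :: s) by [].
  have := independent_size primeI indjs => /= szjs.
  have [|t [indt szt algt]] := IH (j :: s) _ indjs.
    by move: szs szjs => /=; move: (size s) => l; lia.
  by exists t; split=> //; exact: ltnW.
by exists s; split=> // j; apply: NNPP => nalg; apply: nex; exists j.
Qed.

(** If no coordinate could be added, all would be algebraic over [tower s] modulo [I]. Since [J]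
    meets [tower s] only in 0, adjoining the coordinates one by one would then give [J = I]. *)
Lemma independent_extend I J s : prime_ideal I -> prime_ideal J ->
  (forall u, I u -> J u) -> (exists2 g, J g & ~ I g) -> independent J s ->
  exists j, independent I (j :: s).
Proof.
move=> primeI primeJ IJ [g Jg nIg] indJ; apply: NNPP => nex.
have indI := independent_sub primeI primeJ IJ indJ.
have algs j : algebraic_mod I (tower s) 'X_j.
  by apply: NNPP => nalg; apply: nex; exists j.
have JI t (d : dom (tower (t ++ s))) :
    J (emb (tower (t ++ s)) d) -> I (emb (tower (t ++ s)) d).
  elim: t d => [d /(independent_inj primeJ indJ) ->|j t IH].
    by rewrite rmorph0; exact: prime0.
  by apply: contraction_adjoin => //; exact: algebraic_mod_cat.
have [d Ed] : exists d, emb (tower (enum 'I_n ++ s)) d = g.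
  by apply: tower_full => j; rewrite mem_cat mem_enum.
by apply: nIg; rewrite -Ed; apply: JI; rewrite Ed.
Qed.

(** Over a maximal independent set at least as long as [s], each remaining coordinate is algebraic
    and contributes one relation when adjoined. *)
Lemma independent_generators I s : prime_ideal I -> independent I s ->
  exists Ps : seq {mpoly K[n]}, [/\ (size Ps <= n - size s)%N, forall P, P \in Ps -> I P &
    forall g, I g -> exists2 l, ~ I l & in_span Ps (l * g)].
Proof.
move=> primeI /(exists_maximal_independent primeI) [{}s' [inds szs algs]].
have gen t : exists Ps : seq {mpoly K[n]}, [/\ size Ps = size t,
    forall P, P \in Ps -> I P & generically_spans I Ps (tower (t ++ s'))].
  elim: t => [|j t [Ps [szP IPs spanP]]].
    exists [::]; split=> // d /(independent_inj primeI inds) ->.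
    by exists 1; [exact: prime1|rewrite rmorph0 mulr0].
  have [P IP spanP'] := generically_spans_adjoin primeI spanP (algebraic_mod_cat t primeI (algs j)).
  exists (P :: Ps); split=> //=; first by rewrite szP.
  by move=> Q; rewrite inE => /predU1P [->|/IPs].
have [Ps [szP IPs spanP]] := gen [seq j <- enum 'I_n | j \notin s'].
exists Ps; split=> //.
  have /card_uniqP card_cat : uniq ([seq j <- enum 'I_n | j \notin s'] ++ s').
    rewrite cat_uniq filter_uniq ?enum_uniq // (independent_uniq primeI inds) andbT.
    by apply/hasPn => j js'; rewrite mem_filter negb_and negbK js'.
  rewrite szP (leq_trans _ (leq_sub2l n szs)) // leq_subRL ?(independent_size primeI inds) //.
  by rewrite addnC -size_cat -card_cat -[X in (_ <= X)%N]card_ord max_card.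
move=> g Ig; have [d Ed] : exists d, emb (tower ([seq j <- enum 'I_n | j \notin s'] ++ s')) d = g.
  by apply: tower_full => j; rewrite mem_cat mem_filter mem_enum andbT orNb.
by rewrite -Ed; apply: spanP; rewrite Ed.
Qed.

End CoordinateTower.

(** * Dimension and Jacobian minors *)

Lemma zclosed_hypersurface (K : fieldType) (n : nat) (X : ('I_n -> K) -> Prop) a :
  zclosed X -> zclosed (fun x => X x /\ a.@[x] = 0).
Proof.
case=> P XP; exists (fun g => P g \/ g = a) => x; split.
  by case=> /XP Px ax g [/Px|->].
by move=> Px; split; [apply/XP => g Pg|]; apply: Px; [left|right].
Qed.

Lemma vanishing_prime (K : fieldType) (n : nat) (X : ('I_n -> K) -> Prop) :
  irreducible_var X -> prime_ideal (vanishing_ideal X).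
Proof.
case=> closedX [x0 Xx0] irrX; split.
- by move=> x _; rewrite meval0.
- by move=> a b Ia Ib x Xx; rewrite mevalD Ia // Ib // addr0.
- by move=> r a Ia x Xx; rewrite mevalM Ia // mulr0.
- by move=> /(_ x0 Xx0); rewrite meval1 => /eqP; rewrite oner_eq0.
move=> a b Iab.
case: (irrX _ _ (zclosed_hypersurface a closedX) (zclosed_hypersurface b closedX)).
- move=> x; split; last by case; case.
  move=> Xx; have /eqP := Iab x Xx; rewrite mevalM mulf_eq0.
  by case/orP => /eqP E; [left|right].
- by move=> E; left => x /E [].
- by move=> E; right => x /E [].
Qed.

(** Going up the chain the ideals shrink strictly: an independent set of coordinates stays
    independent and gains one member. *)
Lemma chain_independent (K : fieldType) (n : nat) (X : ('I_n -> K) -> Prop) r :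
  irreducible_var X -> has_chain X r ->
  exists2 s, independent (vanishing_ideal X) s & size s = r.
Proof.
move=> irrX [C [irrC ltC CX]].
have ind i : (i <= r)%N ->
    exists2 s, independent (vanishing_ideal (C i)) s & size s = i.
  elim: i => [|i IH] ir; first by exists [::].
  have [s inds szs] := IH (ltnW ir).
  have [CC [y [Cy nCy]]] := ltC _ ir.
  have primeCi := vanishing_prime (irrC _ (ltnW ir)).
  have primeCi1 := vanishing_prime (irrC _ ir).
  have [||j indj] := independent_extend primeCi1 primeCi _ _ inds.
  - by move=> u Iu x /CC; exact: Iu.
  - case: (irrC _ (ltnW ir)) => -[P CP] _ _.
    apply: NNPP => nex; apply: nCy; apply/CP => g Pg; apply: NNPP => gy.
    by apply: nex; exists g => [x /CP/(_ _ Pg)|/(_ y Cy)].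
  by exists (j :: s) => //=; rewrite szs.
have [s inds szs] := ind _ (leqnn r); exists s => //.
apply: independent_sub inds; [exact: vanishing_prime|exact/vanishing_prime/irrC|].
by move=> u Iu x /CX; exact: Iu.
Qed.

Lemma in_spanE (R : comNzRingType) (Ps : seq R) u : in_span Ps u ->
  exists h : 'I_(size Ps) -> R, u = \sum_k h k * Ps`_k.
Proof.
elim: Ps u => /= [u ->|P Ps IH u [h /IH [h' Eu]]].
  by exists (fun _ => 0); rewrite big_ord0.
exists (fun k => oapp h' h (unlift ord0 k)).
rewrite big_ord_recl unlift_none /= -[LHS](subrK (h * P)) Eu addrC; congr (_ + _).
by apply: eq_bigr => k _; rewrite liftK.
Qed.

(** Differentiating [l * g = sum h * P] on [X], where [g] and the [P] vanish, expresses [l] times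
    the gradient of [g] through at most [n - r] gradients. A larger minor, multiplied by the [l],
    thus vanishes on [X], and primality removes the [l]. *)
Lemma jacobian_minor_vanishes (K : fieldType) (n : nat) (X : ('I_n -> K) -> Prop) r m
    (g : 'I_m -> {mpoly K[n]}) (col : 'I_m -> 'I_n) :
  irreducible_var X -> has_chain X r -> (n - r < m)%N ->
  (forall i, vanishing_ideal X (g i)) ->
  vanishing_ideal X (\det (\matrix_(i, j) mderiv (col j) (g i))).
Proof.
move=> irrX chainX ltm Ig; have primeI := vanishing_prime irrX.
have [s inds szs] := chain_independent irrX chainX.
have [Ps [szP IPs genP]] := independent_generators primeI inds.
have /functional_choice [l lP] : forall i, exists l, ~ vanishing_ideal X l /\
    exists h : 'I_(size Ps) -> _, l * g i = \sum_k h k * Ps`_k.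
  by move=> i; have [l nIl /in_spanE] := genP _ (Ig i); exists l.
have /functional_choice [h hP] := fun i => (lP i).2.
set M := \matrix_(i, j) _.
have : vanishing_ideal X (\prod_i l i * \det M).
  move=> x Xx; rewrite mevalM rmorph_prod -det_map_mx.
  have -> : \prod_i meval x (l i) = \det (diag_mx (\row_i (l i).@[x])).
    by rewrite det_diag; apply: eq_bigr => i _; rewrite mxE.
  rewrite -det_mulmx.
  set A := (X in \det X).
  have -> : A = (\matrix_(i, k) (h i k).@[x]) *m
                \matrix_(k < size Ps, j < m) (mderiv (col j) (nth 0 Ps k)).@[x].
    apply/matrixP => i j; rewrite /A mul_diag_mx !mxE.
    have Pk (k : 'I_(size Ps)) : (nth 0 Ps k).@[x] = 0 by apply: IPs => //; exact: mem_nth.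
    have := congr1 (fun u => (mderiv (col j) u).@[x]) (hP i).
    rewrite /= mderivM mevalD !mevalM Ig // mulr0 add0r => ->.
    rewrite (raddf_sum (mderiv _)) (raddf_sum (meval x)) /=; apply: eq_bigr => k _.
    by rewrite mderivM mevalD !mevalM Pk mulr0 add0r !mxE.
  apply/eqP; apply: contraTT (ltm) => detn0.
  rewrite -leqNgt; apply: leq_trans (leq_trans szP _); last by rewrite szs.
  move: detn0; rewrite -unitfE -/(_ \in unitmx) => /mxrank_unit {1}<-.
  exact: mulmx_max_rank.
case/(primeP primeI) => // Ip; exfalso; move: Ip.
apply: (big_ind (fun u => ~ vanishing_ideal X u)); first exact: prime1.
  exact: nprimeM.
by move=> i _; case: (lP i).
Qed.

(** * Descent of the vanishing ideal to a perfect field *)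

Lemma meval_map_mpoly (n : nat) (R S : comNzRingType) (f : {rmorphism R -> S})
    (v : 'I_n -> R) (p : {mpoly R[n]}) :
  (map_mpoly f p).@[fun i => f (v i)] = f p.@[v].
Proof.
rewrite [p.@[v]]mevalE [in LHS](mpolyE p) (rmorph_sum (map_mpoly f)).
rewrite (rmorph_sum (meval _)) (rmorph_sum f) /=.
apply: eq_bigr => m _; rewrite map_mpolyZ map_mpolyX mevalZ mevalX rmorphM rmorph_prod.
by congr (_ * _); apply: eq_bigr => i _; rewrite rmorphXn.
Qed.

Lemma mderiv_map_mpoly (n : nat) (R S : comNzRingType) (f : {rmorphism R -> S})
    (i : 'I_n) (p : {mpoly R[n]}) :
  mderiv i (map_mpoly f p) = map_mpoly f (mderiv i p).
Proof.
rewrite (mpolyE p) (raddf_sum (map_mpoly f)) !(raddf_sum (mderiv i)) (raddf_sum (map_mpoly f)) /=.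
apply: eq_bigr => m _; rewrite map_mpolyZ map_mpolyX !mderivZ !mderivX.
by rewrite !map_mpolyZ map_mpolyX rmorph_nat.
Qed.

(** With the zero ideal, [exists_minimal] yields minimal relations of elements of [K]. *)
Lemma prime_zero (K : fieldType) : prime_ideal (fun u : K => u = 0).
Proof.
split=> //.
- by move=> a b -> ->; rewrite addr0.
- by move=> r a ->; rewrite mulr0.
- by apply/eqP; rewrite oner_eq0.
by move=> a b /eqP; rewrite mulf_eq0 => /orP [] /eqP; [left|right].
Qed.

Section GaloisDescent.
Variables (F : fieldType) (K : closedFieldType) (iota : {rmorphism F -> K}).
Hypothesis algK : is_alg_closure iota.

(* A partial [F]-automorphism of [K]: it sends [src d] to [tgt d], and is well
   defined on the image of [src] by [spec_ker]. *)
Record specialization := Specialization {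
  sdom : idomainType;
  sbase : {rmorphism F -> sdom};
  src : {rmorphism sdom -> K};
  tgt : {rmorphism sdom -> K};
  src_base : forall a, src (sbase a) = iota a;
  tgt_base : forall a, tgt (sbase a) = iota a;
  spec_ker : forall d, src d = 0 -> tgt d = 0 }.

(** A nonzero [src d] is algebraic over [F] and satisfies a relation with nonzero constant term. The
    same relation holds for [tgt d], which therefore is not 0. *)
Lemma spec_inj (s : specialization) d : tgt s d = 0 -> src s d = 0.
Proof.
move=> td0; apply/eqP; apply: contraT => sd0.
have [q [q0 rootq]] := algK (src s d).
have [r [r0 rootr]] : exists r : {poly F}, r`_0 != 0 /\ root (map_poly iota r) (src s d).
  have [m] := ubnP (size q); elim: m q q0 rootq => // m IH q q0 rootq szq.
  have [q00|q00] := eqVneq q`_0 0; last by exists q.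
  have Eq : q = drop_poly 1 q * 'X.
    rewrite -[LHS](poly_take_drop 1) [take_poly 1 q](_ : _ = 0) ?add0r ?expr1 //.
    by apply/polyP => -[|i]; rewrite coef_take_poly coef0.
  have qd0 : drop_poly 1 q != 0 by apply: contra_neq q0 => qd0; rewrite Eq qd0 mul0r.
  apply: (IH (drop_poly 1 q)) => //.
    have : root (map_poly iota (drop_poly 1 q * 'X)) (src s d) by rewrite -Eq.
    rewrite rmorphM /= map_polyX rootM => /orP [//|].
    by rewrite rootX (negPf sd0).
  have : (size (drop_poly 1 q * 'X)%R < m.+1)%N by rewrite -Eq.
  by rewrite size_mulX // ltnS.
move/eqP: rootr; rewrite (_ : map_poly iota r = map_poly (src s) (map_poly (sbase s) r)).
  rewrite horner_map => /spec_ker /=; rewrite -horner_map -map_poly_comp td0 horner_coef0.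
  rewrite coef_map /= tgt_base => /eqP; rewrite fmorph_eq0 => r00.
  by rewrite r00 in r0.
by rewrite -map_poly_comp; apply: eq_map_poly => a; rewrite /= src_base.
Qed.

Definition spec_swap (s : specialization) : specialization :=
  Specialization (tgt_base s) (src_base s) (@spec_inj s).

(** With [f] a minimal relation of [w], every root of its transport is an admissible image of [w]:
    pseudo-division by [f] transports all other relations, as [tgt] does not kill the leading
    coefficient of [f]. *)
Lemma spec_extension_poly (s : specialization) (w : K) :
  exists f : {poly sdom s}, [/\ src s (lead_coef f) != 0, (map_poly (src s) f).[w] = 0 &
    forall w', (map_poly (tgt s) f).[w'] = 0 -> forall p : {poly sdom s},
      (map_poly (src s) p).[w] = 0 -> (map_poly (tgt s) p).[w'] = 0].
Proof.
have primeK := prime_zero K.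
have alg_w : algebraic_mod (fun u : K => u = 0) (Extension (src s)) w.
  have [q [q0 /eqP rootq]] := algK w; exists (map_poly (sbase s) q).
  rewrite lead_coef_map /= src_base; split.
    by apply/eqP; rewrite fmorph_eq0 lead_coef_eq0.
  change ((map_poly (src s) (map_poly (sbase s) q)).[w] = 0).
  rewrite -map_poly_comp -[RHS]rootq; congr (_.[_]).
  by apply: eq_map_poly => a; rewrite /= src_base.
have [f [/eqP lf fw minf]] := exists_minimal primeK alg_w.
exists f; split=> // w' fw' p pw.
have f0 : f != 0 by apply: contraNneq lf => ->; rewrite lead_coef0 rmorph0.
have Ep := Pdiv.Idomain.divp_eq p f.
move: Ep; set e := scalp p f; set h := p %/ f; set r := p %% f => Ep.
have szr : (size r < size f)%N by rewrite ltn_modp.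
have rw : (map_poly (src s) r).[w] = 0.
  move/(congr1 (fun u => (map_poly (src s) u).[w])): Ep.
  rewrite -mul_polyC rmorphM rmorphD rmorphM /= hornerM hornerD hornerM pw mulr0.
  by have -> : (map_poly (src s) f).[w] = 0 := fw; rewrite mulr0 add0r.
have r0 i : tgt s r`_i = 0 by apply: spec_ker; exact: minf szr rw i.
have rw' : (map_poly (tgt s) r).[w'] = 0.
  by rewrite horner_coef big1 // => i _; rewrite coef_map /= r0 mul0r.
move/(congr1 (fun u => (map_poly (tgt s) u).[w'])): Ep.
rewrite -mul_polyC rmorphM rmorphD rmorphM /= hornerM hornerD hornerM fw' rw' mulr0 addr0 => /eqP.
rewrite mulf_eq0 => /orP [|/eqP //]; rewrite map_polyC hornerC.
move=> /eqP tle0; have : tgt s (lead_coef f) ^+ e == 0.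
  by apply/eqP; rewrite -rmorphXn; exact: tle0.
rewrite expf_eq0 => /andP [_ /eqP /spec_inj l0]; move: lf; rewrite l0.
by rewrite eqxx.
Qed.

Definition spec_extends (s s' : specialization) :=
  exists i : {rmorphism sdom s -> sdom s'},
    (forall d, src s' (i d) = src s d) /\ (forall d, tgt s' (i d) = tgt s d).

Definition spec_adjoin (s : specialization) (w w' : K)
    (H : forall p : {poly sdom s},
      (map_poly (src s) p).[w] = 0 -> (map_poly (tgt s) p).[w'] = 0) : specialization.
Proof.
refine (@Specialization {poly sdom s} (polyC \o sbase s : {rmorphism F -> {poly sdom s}})
  (horner_eval w \o map_poly (src s) : {rmorphism {poly sdom s} -> K})
  (horner_eval w' \o map_poly (tgt s) : {rmorphism {poly sdom s} -> K}) _ _ H).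
- by move=> a; rewrite -(src_base s a) /= map_polyC /horner_eval hornerC.
- by move=> a; rewrite -(tgt_base s a) /= map_polyC /horner_eval hornerC.
Defined.

Lemma spec_adjoin_extends s w w' H : spec_extends s (@spec_adjoin s w w' H).
Proof.
exists (polyC : {rmorphism sdom s -> {poly sdom s}}); split=> d /=.
  by rewrite map_polyC /horner_eval hornerC.
by rewrite map_polyC /horner_eval hornerC.
Qed.

Lemma spec_adjoin_src s w w' H : exists d, src (@spec_adjoin s w w' H) d = w.
Proof. by exists 'X; rewrite /= map_polyX /horner_eval hornerX. Qed.

Lemma spec_adjoin_tgt s w w' H (d : sdom (@spec_adjoin s w w' H)) :
  src (@spec_adjoin s w w' H) d = w -> tgt (@spec_adjoin s w w' H) d = w'.
Proof.
move=> sd; have /(spec_ker (s := spec_adjoin H)) :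
    src (spec_adjoin H) (d - ('X : {poly sdom s})) = 0.
  by rewrite rmorphB sd /= map_polyX /horner_eval hornerX subrr.
by rewrite rmorphB /= map_polyX /horner_eval hornerX => /eqP; rewrite subr_eq0 => /eqP.
Qed.

Lemma spec_extends_trans s1 s2 s3 :
  spec_extends s1 s2 -> spec_extends s2 s3 -> spec_extends s1 s3.
Proof.
move=> [i [si ti]] [j [sj tj]]; exists (j \o i : {rmorphism _ -> _}).
by split=> d /=; rewrite ?sj ?tj ?si ?ti.
Qed.

Lemma spec_extend1 s w : exists2 s', spec_extends s s' & exists d, src s' d = w.
Proof.
have [f [lf fw Hf]] := spec_extension_poly s w.
have /closed_rootP [w' /eqP fw'] : size (map_poly (tgt s) f) != 1%N.
  have tl0 : tgt s (lead_coef f) != 0 by apply: contraNneq lf => /spec_inj ->.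
  rewrite size_poly_eq //; apply/negP => /size_poly1P [c c0 Ef].
  move: fw; rewrite Ef map_polyC hornerC /= => sc0.
  by move: lf; rewrite Ef lead_coefC sc0 eqxx.
exists (spec_adjoin (Hf w' fw')); first exact: spec_adjoin_extends.
exact: spec_adjoin_src.
Qed.

(** Each argument involves finitely many elements of [K], so finite extensions replace a full
    automorphism of [K]. *)
Lemma spec_extend_seq s (ws : seq K) :
  exists2 s', spec_extends s s' & forall w, w \in ws -> exists d, src s' d = w.
Proof.
elim: ws => [|w ws [s1 ext1 H1]].
  by exists s => //; exists (idfun : {rmorphism _ -> _}).
have [s2 ext2 [d Ed]] := spec_extend1 s1 w.
exists s2; first exact: spec_extends_trans ext1 ext2.
move=> u; rewrite inE => /predU1P [->|/H1 [e Ee]]; first by exists d.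
by case: ext2 => i [si _]; exists (i e); rewrite si.
Qed.

Definition spec_id : specialization :=
  @Specialization F (idfun : {rmorphism F -> F}) iota iota
    (fun _ => erefl) (fun _ => erefl) (fun _ => id).

Lemma coef_pFrobenius (L : fieldType) p (c : {poly L}) i :
  p \in [pchar L] -> (c ^+ p)`_(i * p) = c`_i ^+ p.
Proof.
move=> charLp; have charPp : p \in [pchar {poly L}] by rewrite pchar_poly.
have p0 : (0 < p)%N by rewrite prime_gt0 ?(pcharf_prime charLp).
rewrite -[in LHS](coefK c) poly_def -(pFrobenius_autE charPp) rmorph_sum /=.
rewrite coef_sum (eq_bigr (fun j : 'I_(size c) => if j == i :> nat then c`_j ^+ p else 0)).
  case: (ltnP i (size c)) => [lti|lei].
    rewrite (bigD1 (Ordinal lti)) //= eqxx big1 ?addr0 // => j.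
    by rewrite -val_eqE /= => /negPf ->.
  rewrite [c`_i]nth_default // expr0n eqn0Ngt p0 big1 // => j _.
  by rewrite ifF //; apply/negP => /eqP ji; move: (ltn_ord j); rewrite ji ltnNge lei.
move=> j _; rewrite pFrobenius_autE exprZn -exprM coefZ coefXn eqn_pmul2r // eq_sym.
by case: ifP; rewrite ?mulr1 ?mulr0.
Qed.

(** If [m] is invertible in [F], the coefficient below the leading one is [- m z]. Otherwise the
    characteristic [p] divides [m], and perfectness allows taking a [p]-th root of the polynomial
    over [F] and passing to [m / p]. *)
Lemma perfect_linear_power (z : K) m (g : {poly F}) : perfect_field F ->
  (0 < m)%N -> map_poly iota g = ('X - z%:P) ^+ m -> exists a, z = iota a.
Proof.
move=> perfF; have [k] := ubnP m; elim: k m g => // k IH m g mk m0 Eg.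
have [mF0|mF0] := eqVneq (m%:R : F) 0; last first.
  have /(congr1 (fun u : {poly K} => u`_m.-1)) := Eg.
  rewrite coef_map /=.
  have -> : ('X - z%:P) ^+ m = \prod_(x <- nseq m z) ('X - x%:P).
    by rewrite big_nseq -Monoid.iteropE.
  rewrite -{3}(size_nseq m z) coefPn_prod_XsubC ?size_nseq -?lt0n //.
  rewrite big_nseq -Monoid.iteropE /= => Ez.
  exists (- g`_m.-1 / m%:R); rewrite rmorphM fmorphV rmorphN rmorph_nat Ez opprK.
  rewrite (_ : iterop _ _ _ _ = z *+ m) // -(mulr_natr z) mulfK //.
  by rewrite -(rmorph_nat iota) fmorph_eq0.
have [p charFp] := natf0_pchar m0 (introT eqP mF0).
have charKp : p \in [pchar K] by apply: rmorph_pchar iota _ charFp.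
have /dvdnP [q Em] : (p %| m)%N by rewrite (dvdn_pcharf charFp) mF0.
have p_gt1 : (1 < p)%N by rewrite prime_gt1 ?(pcharf_prime charFp).
have q0 : (0 < q)%N by case: q Em m0 => // ->.
(* The [p]-th power of each coefficient is a coefficient of [g]; its root in [F] is the right one
   because Frobenius is injective on [K]. *)
have [b Hb] : exists b : nat -> F, forall i, (('X - z%:P) ^+ q)`_i = iota (b i).
  apply: (functional_choice (fun i b => (('X - z%:P) ^+ q)`_i = iota b)) => i.
  have [b Eb] := perfF p charFp g`_(i * p).
  exists b; suff E : (('X - z%:P) ^+ q)`_i ^+ p = iota b ^+ p.
    by apply: (fmorph_inj (pFrobenius_aut charKp : {rmorphism K -> K})); exact: E.
  by rewrite -coef_pFrobenius // -exprM -Em -Eg coef_map /= -Eb rmorphXn.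
apply: (IH q (\poly_(i < q.+1) b i)) => //.
  by rewrite -ltnS (leq_trans _ mk) // ltnS Em ltn_Pmulr.
apply/polyP => i; rewrite coef_map /= coef_poly; case: ltnP => // qi.
by rewrite rmorph0 nth_default // size_exp_XsubC.
Qed.

(** All roots of the minimal relation of [z] are conjugates, hence equal to [z], so that relation is
    a multiple of a power of ['X - z]. *)
Lemma fixed_rational (z : K) : perfect_field F ->
  (forall z', (forall p, (map_poly iota p).[z] = 0 -> (map_poly iota p).[z'] = 0) -> z' = z) ->
  exists a, z = iota a.
Proof.
move=> perfF fixz; have [f [/= lf fz Hf]] := spec_extension_poly spec_id z.
have [r Er] := closed_field_poly_normal (map_poly iota f).
have f0 : f != 0 by apply: contraNneq lf => ->; rewrite lead_coef0 rmorph0.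
have lmf0 : lead_coef (map_poly iota f) != 0 by rewrite lead_coef_eq0 map_poly_eq0.
have rz : all (pred1 z) r.
  apply/allP => w wr; apply/eqP/fixz/Hf.
  by rewrite /= Er hornerZ; apply/eqP; rewrite mulf_eq0 -/(root _ _) root_prod_XsubC wr orbT.
have r0 : (0 < size r)%N.
  move: fz; rewrite /= Er; case: (r) => //; rewrite big_nil hornerZ hornerC mulr1.
  by move/eqP; rewrite (negPf lmf0).
apply: (perfect_linear_power (m := size r) (g := (lead_coef f)^-1 *: f)) => //.
rewrite linearZ /= Er scalerA lead_coef_map fmorphV mulVf ?scale1r.
  by rewrite (all_pred1P _ _ rz) size_nseq big_nseq -Monoid.iteropE.
by rewrite fmorph_eq0 lead_coef_eq0.
Qed.

Section DefinedOver.
Variables (n : nat) (X : ('I_n -> K) -> Prop).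
Hypotheses (perfF : perfect_field F) (defX : defined_over iota X).

Lemma map_mpoly_trans (R S U : comNzRingType) (f : {rmorphism R -> S})
    (g : {rmorphism S -> U}) (h : {rmorphism R -> U}) (p : {mpoly R[n]}) :
  (forall a, g (f a) = h a) -> map_mpoly g (map_mpoly f p) = map_mpoly h p.
Proof. by move=> gf; apply/mpolyP => m; rewrite !mcoeff_map_mpoly; exact: gf. Qed.

Lemma spec_point (s : specialization) (xi : 'I_n -> sdom s) :
  X (fun i => tgt s (xi i)) -> X (fun i => src s (xi i)).
Proof.
case: defX => P [defP XP] /XP Xt; apply/XP => g Pg; have [h Eg] := defP _ Pg.
rewrite Eg -(map_mpoly_trans (f := sbase s) (g := src s)); last exact: src_base.
rewrite meval_map_mpoly; apply: spec_inj; rewrite -meval_map_mpoly.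
rewrite (map_mpoly_trans (h := iota)); last exact: tgt_base.
by rewrite -Eg; exact: Xt.
Qed.

(** To evaluate the transported polynomial at [x], the swapped specialization is extended to the
    coordinates of [x]. It moves [x] to a point of [X], where the original polynomial vanishes, and
    [spec_inj] carries this back. *)
Lemma vanishing_spec (s : specialization) (G : {mpoly sdom s[n]}) :
  vanishing_ideal X (map_mpoly (src s) G) -> vanishing_ideal X (map_mpoly (tgt s) G).
Proof.
move=> IG x Xx.
have [s' [i [si ti]] H] := spec_extend_seq (spec_swap s) (codom x).
have /functional_choice [xi Exi] j := H (x j) (codom_f x j).
have Ex : x = fun j => src s' (xi j) by apply: functional_extensionality => j; rewrite Exi.
rewrite Ex -(map_mpoly_trans (f := i) (g := src s')) //; rewrite meval_map_mpoly.
apply: spec_inj; rewrite -meval_map_mpoly (map_mpoly_trans (h := src s)) //.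
by apply: IG; apply: (spec_point (s := spec_swap s')); rewrite /= -Ex.
Qed.

Lemma vanishingB a b : vanishing_ideal X a -> vanishing_ideal X b ->
  vanishing_ideal X (a - b).
Proof. by move=> Ia Ib x Xx; rewrite mevalB Ia // Ib // subrr. Qed.

Lemma vanishingZ c a : vanishing_ideal X a -> vanishing_ideal X (c *: a).
Proof. by move=> Ia x Xx; rewrite mevalZ Ia // mulr0. Qed.

Lemma msupp_size_lt (L : comNzRingType) (p q : {mpoly L[n]}) m :
  {subset msupp q <= msupp p} -> m \in msupp p -> q@_m = 0 ->
  (size (msupp q) < size (msupp p))%N.
Proof.
move=> sqp mp qm; rewrite (perm_size (perm_to_rem mp)) /= ltnS.
apply: uniq_leq_size => // m' m'q; rewrite mem_rem_uniq // inE sqp // andbT.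
by apply: contraTneq m'q => ->; rewrite mcoeff_msupp qm eqxx.
Qed.

(* An element of minimal support, normalized to have a coefficient 1, is fixed
   by every specialization, so its coefficients are in [F]. *)
Lemma exists_rational_vanishing g : vanishing_ideal X g -> g != 0 ->
  exists h : {mpoly F[n]}, [/\ h != 0, vanishing_ideal X (map_mpoly iota h) &
    {subset msupp (map_mpoly iota h) <= msupp g}].
Proof.
have [k] := ubnP (size (msupp g)); elim: k g => // k IH g szg Ig g0.
case: (classic (exists g', [/\ vanishing_ideal X g', g' != 0,
    {subset msupp g' <= msupp g} & (size (msupp g') < size (msupp g))%N])).
  case=> g' [Ig' g'0 sub sz]; have [|h [h0 Ih subh]] := IH g' _ Ig' g'0.
    by apply: leq_trans sz _; rewrite -ltnS.
  by exists h; split=> // m /subh /sub.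
move=> nex; set m0 := mlead g; have m0g : m0 \in msupp g by exact: mlead_supp.
have gm0 : g@_m0 != 0 by rewrite -mcoeff_msupp.
set v := (g@_m0)^-1 *: g.
have Iv : vanishing_ideal X v by exact: vanishingZ.
have suppv : msupp v =i msupp g by apply/perm_mem/msuppZ; rewrite invr_eq0.
have vm0 : v@_m0 = 1 by rewrite mcoeffZ mulVf.
have [a Ea] : exists a, forall m, v@_m = iota (a m).
  apply: (functional_choice (fun m b => v@_m = iota b)) => m.
  apply: fixed_rational => // z' Hz'.
  (* [z'] is an arbitrary conjugate of the coefficient at [m]; the specialization sending one to the
     other is extended to all coefficients of [v]. *)
  set s0 := @spec_adjoin spec_id v@_m z' Hz'.
  have [s [i [si ti]] H] := spec_extend_seq s0 [seq v@_m | m <- msupp v].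
  have [dm Edm] := @spec_adjoin_src spec_id _ _ Hz'.
  have Etm := @spec_adjoin_tgt spec_id _ _ Hz' dm Edm.
  have /functional_choice [c Ec] : forall m', exists c, src s c = v@_m'.
    move=> m'; have [m'v|m'v] := boolP (m' \in msupp v); first by apply/H/map_f.
    by exists 0; rewrite rmorph0 memN_msupp_eq0.
  pose G : {mpoly sdom s[n]} := \sum_(m' <- msupp v) c m' *: 'X_[m'].
  have EG m' : tgt s G@_m' = tgt s (c m').
    rewrite /G raddf_sum /= (eq_bigr (fun m1 => if m1 == m' then c m1 else 0)); last first.
      by move=> m1 _; rewrite mcoeffZ mcoeffX; case: eqP; rewrite ?mulr1 ?mulr0.
    have [m'v|m'v] := boolP (m' \in msupp v).
      by rewrite (bigD1_seq m') //= eqxx big1 ?addr0 // => m1 /negPf ->.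
    rewrite big_seq_cond big1 => [|m1 /andP [m1v _]]; last first.
      by case: eqP => // m1m'; rewrite -m1m' m1v in m'v.
    by rewrite rmorph0; apply/esym/spec_ker; rewrite Ec memN_msupp_eq0.
  have sG : map_mpoly (src s) G = v.
    rewrite [RHS]mpolyE raddf_sum /=; apply: eq_bigr => m1 _.
    by rewrite map_mpolyZ map_mpolyX Ec.
  (* At [m0] both [v] and its conjugate have coefficient 1, so the difference has smaller support
     than [g] and is 0 by minimality. Its coefficient at [m] is [v@_m - z']. *)
  have IG' : vanishing_ideal X (v - map_mpoly (tgt s) G).
    by apply: vanishingB => //; apply: vanishing_spec; rewrite sG.
  have tc (m1 : 'X_{1..n}) d : src s d = v@_m1 -> tgt s (c m1) = tgt s d.
    move=> Ed; apply/eqP; rewrite -subr_eq0 -rmorphB; apply/eqP/spec_ker.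
    by rewrite rmorphB Ec Ed subrr.
  apply/eqP; rewrite eq_sym -subr_eq0.
  have -> : v@_m - z' = (v - map_mpoly (tgt s) G)@_m.
    rewrite mcoeffB mcoeff_map_mpoly /= EG (tc m (i dm)) ?ti ?Etm //.
    by rewrite si Edm.
  set w := v - _; have [->|w0] := eqVneq w 0; first by rewrite mcoeff0.
  have subw : {subset msupp w <= msupp g}.
    move=> m1; rewrite -suppv !mcoeff_msupp; apply: contraNneq => vm1.
    by rewrite mcoeffB mcoeff_map_mpoly /= EG vm1 sub0r (tc m1 0) ?rmorph0 ?oppr0.
  exfalso; apply: nex; exists w; split=> //.
  apply: (msupp_size_lt subw m0g).
  by rewrite mcoeffB mcoeff_map_mpoly /= EG (tc m0 1) ?rmorph1 ?vm0 ?subrr.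
pose h : {mpoly F[n]} := \sum_(m <- msupp v) a m *: 'X_[m].
have Eh : map_mpoly iota h = v.
  rewrite [RHS]mpolyE raddf_sum /=; apply: eq_bigr => m1 _.
  by rewrite map_mpolyZ map_mpolyX Ea.
exists h; rewrite Eh; split=> // [|m]; last by rewrite suppv.
by apply: contra_eq_neq vm0 => h0; rewrite -Eh h0 raddf0 mcoeff0 eq_sym oner_neq0.
Qed.

(** Subtracting a multiple of the element from [exists_rational_vanishing] cancels a monomial and
    creates no new one. *)
Lemma vanishing_rational_span g : vanishing_ideal X g ->
  exists2 s : seq (K * {mpoly F[n]}),
    forall u, u \in s -> vanishing_ideal X (map_mpoly iota u.2) &
    g = \sum_(u <- s) u.1 *: map_mpoly iota u.2.
Proof.
have [k] := ubnP (size (msupp g)); elim: k g => // k IH g szg Ig.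
have [->|g0] := eqVneq g 0; first by exists [::] => //; rewrite big_nil.
have [h [h0 Ih subh]] := exists_rational_vanishing Ig g0.
set H := map_mpoly iota h.
have H0 : H != 0.
  apply: contra_neq h0 => H0; apply/mpolyP => m; rewrite mcoeff0.
  by apply: (fmorph_inj iota); rewrite rmorph0 -mcoeff_map_mpoly -/H H0 mcoeff0.
have mH := mlead_supp H0; set m := mlead H in mH.
have Hm0 : H@_m != 0 by rewrite -mcoeff_msupp.
set c := g@_m / H@_m.
have [||s Is Es] := IH (g - c *: H).
- rewrite -ltnS; apply: leq_trans szg; rewrite ltnS; apply: (msupp_size_lt (m := m)); last first.
  + by rewrite mcoeffB mcoeffZ divfK // subrr.
  + exact: subh.
  move=> m' /msuppB_le; rewrite mem_cat => /orP [//|/msuppZ_le /subh //].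
- by apply: vanishingB => //; exact: vanishingZ.
exists ((c, h) :: s) => [u|]; first by rewrite inE => /predU1P [->|/Is].
by rewrite big_cons /= -Es addrC subrK.
Qed.

End DefinedOver.
End GaloisDescent.

(** * The conormal space at a non-singular rational point *)

Definition rational_vanishing (F K : fieldType) (iota : {rmorphism F -> K}) (n : nat)
  (X : ('I_n -> K) -> Prop) (g : {mpoly F[n]}) : Prop :=
  vanishing_ideal X (map_mpoly iota g).

Definition gradients (F : fieldType) (n m : nat) (a : 'I_n -> F)
    (g : 'I_m -> {mpoly F[n]}) : 'M[F]_(m, n) :=
  \matrix_(i, j) (mderiv j (g i)).@[a].

(** Take a family of maximal size with independent gradients; a gradient outside their span would
    enlarge it. *)
Lemma exists_gradient_basis (F : fieldType) (n : nat) (a : 'I_n -> F)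
    (I : {mpoly F[n]} -> Prop) :
  exists c (g : 'I_c -> {mpoly F[n]}), [/\ forall i, I (g i),
    row_free (gradients a g) &
    forall h, I h -> (\row_j (mderiv j h).@[a] <= gradients a g)%MS].
Proof.
pose P c := exists2 g : 'I_c -> {mpoly F[n]}, forall i, I (g i) & row_free (gradients a g).
have P0 : P 0%N.
  by exists (fun _ => 0) => [[]//|]; rewrite /row_free flatmx0 mxrank0.
have Pn c : P c -> (c <= n)%N.
  by case=> g _ /eqP <-; exact: rank_leq_col.
have [c [[g Ig freeg] maxc]] : exists c, P c /\ ~ P c.+1.
  apply: NNPP => nex.
  have Pall c : P c.
    elim: c => // c Pc; apply: NNPP => nPc; apply: nex; by exists c.
  by have := Pn _ (Pall n.+1); rewrite ltnn.
exists c, g; split=> // h Ih; apply: contraT => nsub; exfalso; apply: maxc.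
exists (fun i => oapp g h (unlift ord0 i)).
  by move=> i; case: unliftP => [j|] _ /=.
have -> : gradients a (fun i : 'I_c.+1 => oapp g h (unlift ord0 i)) =
    col_mx (\row_j (mderiv j h).@[a]) (gradients a g) :> 'M_(1 + c, n).
  apply/matrixP => i j; rewrite !mxE; case: splitP => k Ek.
    by rewrite mxE (_ : i = ord0) ?unlift_none //; apply: val_inj; rewrite /= Ek (ord1 k).
  rewrite mxE (_ : i = lift ord0 k) ?liftK //; exact: val_inj.
suff : (c < \rank (\row_j (mderiv j h).@[a] + gradients a g)%MS)%N.
  by rewrite addsmxE /row_free eqn_leq rank_leq_row => ltc; exact: ltc.
rewrite -{1}(eqP freeg); apply: rank_ltmx; rewrite /ltmx addsmxSr /=.
by apply: contra nsub; apply: submx_trans; exact: addsmxSl.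
Qed.

Lemma row_free_has_indep (K : fieldType) (n r : nat) (V : ('I_n -> K) -> Prop)
    (M : 'M[K]_(r, n)) :
  row_free M -> (forall i, V (M i)) -> has_indep V r.
Proof.
move=> freeM VM; exists (fun i => M i); split=> // c c0 i.
have : \row_l c l *m M == 0.
  by apply/eqP/rowP => j; rewrite !mxE -[RHS](c0 j); apply: eq_bigr => l _; rewrite mxE.
by rewrite mulmx_free_eq0 // => /eqP /rowP /(_ i); rewrite !mxE.
Qed.

Lemma has_indep_row_free (K : fieldType) (n r : nat) (V : ('I_n -> K) -> Prop) :
  has_indep V r -> exists2 M : 'M[K]_(r, n), row_free M & forall i, V (M i).
Proof.
case=> vs [Vvs ind]; exists (\matrix_(i, j) vs i j); last first.
  move=> i; rewrite (_ : (\matrix_(_, _) _) i = vs i) //.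
  by apply: functional_extensionality => j; rewrite mxE.
apply: inj_row_free => v v0; apply/rowP => i; rewrite mxE.
apply: (ind (fun i => v 0 i)) => j.
have /rowP /(_ j) := v0; rewrite !mxE => {2}<-.
by apply: eq_bigr => l _; rewrite mxE.
Qed.

Lemma kernel_dim (K : fieldType) (n c r : nat) (G : 'M[K]_(c, n))
    (V : ('I_n -> K) -> Prop) :
  row_free G -> (forall v, V v <-> G *m \col_j v j = 0) ->
  subspace_dim V r -> c = (n - r)%N.
Proof.
move=> /eqP rkG VG [/has_indep_row_free [M /eqP rkM VM] nind].
have rcn : (r + c <= n)%N.
  rewrite -rkM -rkG -(mxrank_tr G); apply: mulmx0_rank_max.
  apply/matrixP => i j; have /VG /colP /(_ j) := VM i.
  rewrite !mxE => {2}<-; apply: eq_bigr => l _; rewrite !mxE; exact: mulrC.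
have rkker : \rank (kermx G^T) = (n - c)%N by rewrite mxrank_ker mxrank_tr rkG.
have VB i : V (row_base (kermx G^T) i).
  apply/VG/trmx_inj; rewrite trmx_mul trmx0.
  have -> : (\col_j row_base (kermx G^T) i j)^T = row i (row_base (kermx G^T)).
    by apply/rowP => j; rewrite !mxE.
  apply/sub_kermxP; apply: submx_trans (row_sub _ _) _.
  by rewrite eq_row_base.
have := row_free_has_indep (row_base_free (kermx G^T)) VB.
rewrite rkker; case: (ltngtP c (n - r)%N) => // cnr; last by lia.
(* For [c < n - r] the kernel basis has more than [r] members, and its first [r.+1] contradict the
   maximality of [r]. *)
case=> vs [Vvs ind]; case: nind.
have ltr : (r.+1 <= n - c)%N by lia.
exists (fun i => vs (widen_ord ltr i)); split=> // e e0 i.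
pose e' (l : 'I_(n - c)) := if insub (l : nat) is Some l' then e l' else 0.
have e'E l : e' (widen_ord ltr l) = e l.
  by rewrite /e' /= insubT //= => lr; congr e; exact: val_inj.
rewrite -e'E; apply: ind => j; rewrite -[RHS](e0 j).
rewrite (bigID (fun l : 'I_(n - c) => (l < r.+1)%N)) /= [X in _ + X]big1 ?addr0; last first.
  by move=> l lr; rewrite /e' insubF ?mul0r //; apply/negbTE.
rewrite (big_ord_narrow ltr); apply: eq_bigr => l _; by rewrite e'E.
Qed.

Section NormalFrame.
Variables (F : fieldType) (K : closedFieldType) (iota : {rmorphism F -> K}).
Variables (n : nat) (X : ('I_n -> K) -> Prop) (dX : nat) (a : 'I_n -> F).
Let x0 i := iota (a i).
Hypotheses (perfF : perfect_field F) (algK : is_alg_closure iota).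
Hypotheses (irrX : irreducible_var X) (defX : defined_over iota X).
Hypotheses (chainX : has_chain X dX) (Xx0 : X x0).
Hypothesis (tanX : subspace_dim (tangent_space X x0) dX).

Local Notation I_F := (rational_vanishing iota X).

Lemma rational_vanishing_prime : prime_ideal I_F.
Proof.
have [I0 ID IM I1 IP] := vanishing_prime irrX; rewrite /rational_vanishing; split.
- by rewrite rmorph0.
- by move=> u v Iu Iv; rewrite rmorphD; exact: ID.
- by move=> r u Iu; rewrite rmorphM; exact: IM.
- by rewrite rmorph1.
by move=> u v; rewrite rmorphM; exact: IP.
Qed.

Lemma rational_vanishing_eval h : I_F h -> h.@[a] = 0.
Proof.
move=> Ih; apply: (fmorph_inj iota); rewrite rmorph0 -meval_map_mpoly.
exact: Ih.
Qed.

(** Perfectness enters here: [I(X)] is spanned over [K] by polynomials over [F], so the gradients of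
    the latter already cut out the tangent space. *)
Lemma tangent_space_gradients c (g : 'I_c -> {mpoly F[n]}) v :
  (forall i, I_F (g i)) ->
  (forall h, I_F h -> (\row_j (mderiv j h).@[a] <= gradients a g)%MS) ->
  tangent_space X x0 v <-> map_mx iota (gradients a g) *m \col_j v j = 0.
Proof.
move=> Ig span; have Eder (h : {mpoly F[n]}) j :
    (mderiv j (map_mpoly iota h)).@[x0] = iota (mderiv j h).@[a].
  by rewrite mderiv_map_mpoly meval_map_mpoly.
split=> [tv|Gv].
  apply/colP => i; rewrite !mxE -[RHS](tv _ (Ig i)); apply: eq_bigr => j _.
  by rewrite !mxE Eder.
move=> g0 /(vanishing_rational_span algK perfF defX) [s Is ->].
under eq_bigr => j _ do rewrite (raddf_sum (mderiv j)) (raddf_sum (meval x0)) mulr_suml.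
rewrite exchange_big big_seq_cond big1 // => u /andP [us _] /=.
under eq_bigr => j _ do rewrite mderivZ mevalZ Eder -mulrA.
rewrite -mulr_sumr; have /submxP [r Er] := span _ (Is _ us).
suff -> : \sum_j iota (mderiv j u.2).@[a] * v j = 0 by rewrite mulr0.
have := congr1 (fun N => (map_mx iota r *m N) 0 0) Gv.
rewrite mulmxA -map_mxM -Er mulmx0 !mxE => {2}<-.
by apply: eq_bigr => j _; rewrite !mxE.
Qed.

(* Near [a], the differentials of a gradient basis [g] span all the normal
   directions of [X]: the bordered minors of the Jacobian vanish on [X]. *)
Lemma exists_normal_frame : exists (delta : {mpoly F[n]})
    (g : 'I_(n - dX) -> {mpoly F[n]}), delta.@[a] != 0 /\
  forall h, I_F h -> exists mu : 'I_(n - dX) -> {mpoly F[n]},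
    forall j, I_F (delta * mderiv j h - \sum_i mu i * mderiv j (g i)).
Proof.
have [c [g [Ig freeg span]]] := exists_gradient_basis a I_F.
have freeGK : row_free (map_mx iota (gradients a g)) by rewrite row_free_map.
(* Non-singularity fixes the size of the gradient basis as [n - dX]. *)
have Ec := kernel_dim freeGK (fun v => tangent_space_gradients v Ig span) tanX.
subst c; set c := (n - dX)%N in g Ig freeg span freeGK *.
have fullGT : row_full (gradients a g)^T by rewrite /row_full mxrank_tr.
pose f := fullrankfun fullGT.
(* The columns [f] are independent at [a], so this minor does not vanish there. *)
pose delta := \det (\matrix_(i < c, l < c) mderiv (f l) (g i)).
exists delta, g; split.
  have := fullrowsub_unit fullGT.
  rewrite unitmxE unitfE -det_tr -/f.
  rewrite (_ : _^T = map_mx (meval a) (\matrix_(i < c, l < c) mderiv (f l) (g i))).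
    by rewrite det_map_mx.
  by apply/matrixP => i l; rewrite !mxE.
move=> h Ih; pose gh (i : 'I_c.+1) := oapp g h (unlift ord0 i).
have Igh i : I_F (gh i) by rewrite /gh; case: unliftP => [l|] _ /=.
pose N := \matrix_(i < c.+1, l < c) mderiv (f l) (gh i).
(* Cofactors of the column of [j]-derivatives do not involve [j], so one [mu] serves every [j]. *)
pose cof (i : 'I_c.+1) := (-1) ^+ (i + 0) * \det (row' i N).
exists (fun i => - cof (lift ord0 i)) => j.
pose col (l : 'I_c.+1) := oapp f j (unlift ord0 l).
pose M := \matrix_(i < c.+1, l < c.+1) mderiv (col l) (gh i).
(* Expansion of the bordered minor along its first column; its size exceeds [n - dX], so it vanishes
   on [X]. *)
have -> : delta * mderiv j h - \sum_i - cof (lift ord0 i) * mderiv j (g i) = \det M.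
  rewrite (expand_det_col M ord0) big_ord_recl.
  have cofE i : cofactor M i ord0 = cof i.
    rewrite /cofactor /cof; congr (_ * \det (row' i _)); apply/matrixP => i' l.
    by rewrite !mxE /col liftK.
  congr (_ + _).
    rewrite cofE mxE /col /gh unlift_none /= mulrC /cof /= mul1r; congr (_ * \det _).
    by apply/matrixP => i l; rewrite !mxE /gh liftK.
  rewrite -sumrN; apply: eq_bigr => i _.
  by rewrite cofE mxE /col /gh unlift_none liftK /= mulNr opprK mulrC.
rewrite /rational_vanishing -det_map_mx.
rewrite (_ : map_mx _ M = \matrix_(i, l) mderiv (col l) (map_mpoly iota (gh i))).
  exact: (jacobian_minor_vanishes _ irrX chainX).
by apply/matrixP => i l; rewrite !mxE mderiv_map_mpoly.
Qed.

End NormalFrame.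

(** * Differentiating along the variety *)

Lemma mderiv_prod0 (F : fieldType) (n : nat) (J : finType) (P : pred J)
    (v : 'I_n) (f : J -> {mpoly F[n]}) :
  (forall i, P i -> mderiv v (f i) = 0) -> mderiv v (\prod_(i | P i) f i) = 0.
Proof.
move=> f0; apply: (big_ind (fun u => mderiv v u = 0)) => //.
  by rewrite -mpolyC1 mderivC.
by move=> p q p0 q0; rewrite mderivM p0 q0 mul0r mulr0 addr0.
Qed.

Lemma mderiv_exp (F : fieldType) (n : nat) (v : 'I_n) (p : {mpoly F[n]}) N :
  p * mderiv v (p ^+ N) = N%:R * mderiv v p * p ^+ N.
Proof.
elim: N => [|N IH]; first by rewrite expr0 -mpolyC1 mderivC mulr0 !mul0r.
rewrite exprS mderivM mulrDr mulrCA [p * (p * _)]mulrCA IH -natr1; ring.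
Qed.

Lemma mderiv_var (F : fieldType) (n m : nat) (v : 'I_n) : (m < n)%N ->
  mderiv v (var F n m) = (m == v)%:R.
Proof.
move=> mn; rewrite /var insubT /= mderivX mnmE.
have -> : (Ordinal mn == v) = (m == v) by [].
case: eqP => [Em|_]; last by rewrite scale0r.
rewrite scale1r (_ : (U_(_) - U_(_))%MM = 0%MM) ?mpolyX0 //.
by apply/mnmP => i; rewrite mnmBE !mnmE -val_eqE /= Em subnn.
Qed.

Lemma offset_mono (d : nat -> nat) i j : (i <= j)%N -> (offset d i <= offset d j)%N.
Proof.
move=> ij; rewrite /offset -!(big_mkord xpredT) (big_cat_nat (leq0n i) ij) /=.
exact: leq_addr.
Qed.

Lemma offsetS (d : nat -> nat) i : offset d i.+1 = (offset d i + d i)%N.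
Proof. by rewrite /offset big_ord_recr. Qed.

(** * Mixed partial derivatives of the slicing *)

Section PartialDerivatives.
Variables (F : fieldType) (k : nat) (d : nat -> nat) (T : tidx k d -> F).
Hypothesis k_gt0 : (0 < k)%N.

Local Notation n := (nvars k d).

Definition last_ord : 'I_k :=
  Ordinal (eq_ind_r (fun m => k.-1 < m)%N (leqnn _) (esym (prednK k_gt0))).

(** The last axis belongs to every stage because it indexes the coordinate of the slicing, fixed
    from the start. *)
Definition stage (j : nat) : {set 'I_k} := [set i : 'I_k | (i < j)%N || (i == last_ord)].

(* The coordinate [T_{a (k-1)}] of the slicing, differentiated with respect to
   the variables of index [a 0], ..., [a (j-1)] of the first [j] blocks. *)
Definition partial (j : nat) (a : tidx k d) : {mpoly F[n]} :=
  \sum_(b : tidx k d | [forall i in stage j, b i == a i])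
    (T b)%:MP * \prod_(i : 'I_k | (j <= i)%N && (i != last_ord)) var F n (offset d i + b i).

Lemma block_lt (i : 'I_k) m : i != last_ord -> (m < d i)%N -> (offset d i + m < n)%N.
Proof.
move=> il md; have ik : (i < k.-1)%N.
  by move: il (ltn_ord i); rewrite -val_eqE /=; lia.
apply: (@leq_trans (offset d i.+1)); first by rewrite offsetS -addnS leq_add2l.
exact: offset_mono.
Qed.

Lemma partial_depends j : depends_only (stage j) (partial j).
Proof.
move=> a b ab; apply: eq_bigl => c; apply: eq_forallb => i.
by case: (boolP (i \in stage j)) => //= /ab ->.
Qed.

(** Each monomial is linear in block [i0], and differentiation keeps the terms whose variable in
    that block has index [a i0]. *)
Lemma mderiv_partial (i0 : 'I_k) (a : tidx k d) (il : i0 != last_ord) :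
  mderiv (Ordinal (block_lt il (ltn_ord (a i0)))) (partial i0 a) = partial i0.+1 a.
Proof.
rewrite /partial (raddf_sum (mderiv _)) /= [LHS]big_mkcond [RHS]big_mkcond /=.
apply: eq_bigr => b _.
have -> : [forall i in stage i0.+1, b i == a i] =
    [forall i in stage i0, b i == a i] && (b i0 == a i0).
  apply/forall_inP/andP => [H|[/forall_inP H /eqP b0] i].
    split; last by apply: H; rewrite inE ltnS leqnn.
    apply/forall_inP => i; rewrite inE => ii; apply: H; rewrite inE ltnS.
    by case/orP: ii => [/ltnW ->|->] //; rewrite orbT.
  rewrite inE ltnS leq_eqVlt -orbA => /orP [/eqP/val_inj ->|ii]; first by rewrite b0.
  by apply: H; rewrite inE.
case: ifP => //= _; rewrite mderiv_mulC (bigD1 i0) /=; last by rewrite leqnn.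
rewrite mderivM mderiv_prod0 ?mulr0 ?addr0 => [|i /andP [/andP [i0i il'] ii0]].
  rewrite mderiv_var; last exact: block_lt.
  rewrite /= eqn_add2l (inj_eq val_inj); case: eqP => [_|_]; last by rewrite mul0r mulr0.
  rewrite mul1r; congr (_ * _); apply: eq_bigl => i.
  rewrite ltn_neqAle [i == i0]eq_sym -val_eqE /=.
  by case: (i != last_ord); case: (i0 <= i)%N; rewrite ?andbT ?andbF.
(* A later block starts at [offset d i0.+1] or beyond, so its variables are not the differentiated
   one. *)
rewrite mderiv_var; last exact: block_lt.
rewrite /= gtn_eqF //; apply: (@leq_trans (offset d i0.+1)).
  by rewrite offsetS -addnS leq_add2l.
apply: leq_trans (leq_addr _ _); apply: offset_mono.
by rewrite ltn_neqAle i0i andbT eq_sym.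
Qed.

Lemma partial_last a : partial k.-1 a = (T a)%:MP.
Proof.
have stageT i : i \in stage k.-1.
  rewrite inE -val_eqE /= orbC -leq_eqVlt -ltnS prednK //.
rewrite /partial (big_pred1 a) => [|b].
  rewrite big1 ?mulr1 // => i /andP [ki il].
  by have := stageT i; rewrite inE (negPf il) orbF ltnNge ki.
apply/forall_inP/eqP => [H|-> //]; apply/ffunP => i; apply/eqP/H; exact: stageT.
Qed.

Lemma partial0 (K : fieldType) (iota : {rmorphism F -> K}) (a : tidx k d) :
  map_mpoly iota (partial 0 a) = slicing iota T (a last_ord).
Proof.
rewrite /partial /slicing (rmorph_sum (map_mpoly iota)) /=; apply: eq_big => [b|b _].
  apply/forall_inP/forallP => H i.
    apply/implyP => /eqP il; have -> : i = last_ord by apply: val_inj.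
    by rewrite (inj_eq val_inj); apply: H; rewrite inE eqxx.
  rewrite inE /= => /eqP ->.
  by have := H last_ord; rewrite /= eqxx (inj_eq val_inj).
rewrite rmorphM /= map_mpolyC rmorph_prod /=; congr (_ * _).
apply: eq_big => [i|i _]; first by rewrite -val_eqE.
by rewrite /var; case: insubP => [u _ _|_]; rewrite ?rmorph0 // map_mpolyX.
Qed.

End PartialDerivatives.

(** * Induction over the differentiated blocks *)

Section Iteration.
Variables (F : fieldType) (k : nat) (d : nat -> nat) (T : tidx k d -> F).
Hypothesis k_gt0 : (0 < k)%N.

Local Notation n := (nvars k d).
Local Notation last := (last_ord k_gt0).

Variables (I : {mpoly F[n]} -> Prop) (a0 : 'I_n -> F) (c : nat).
Variables (delta : {mpoly F[n]}) (g : 'I_c -> {mpoly F[n]}).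
Hypotheses (primeI : prime_ideal I) (I_a0 : forall h, I h -> h.@[a0] = 0).
Hypothesis delta_a0 : delta.@[a0] != 0.
Hypothesis frame : forall h, I h -> exists mu : 'I_c -> {mpoly F[n]},
  forall j, I (delta * mderiv j h - \sum_i mu i * mderiv j (g i)).
Hypothesis slices : forall a, I (partial T k_gt0 0 a).

(* The factor [delta ^+ N] clears denominators. Both factors of a product must involve a differentiated block or the last axis. *)
Definition stage_decomp (j : nat) (J : finType) : Prop :=
  exists N (S : J -> {set 'I_k}) (p q : J -> tidx k d -> {mpoly F[n]}),
  [/\ forall t, S t :&: stage k_gt0 j != set0 /\ ~: S t :&: stage k_gt0 j != set0,
      forall t, depends_only (S t :&: stage k_gt0 j) (p t),
      forall t, depends_only (~: S t :&: stage k_gt0 j) (q t) &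
      forall a, I (delta ^+ N * partial T k_gt0 j a - \sum_t p t a * q t a)].

Lemma stage_decomp0 : stage_decomp 0 'I_0.
Proof.
exists 0%N, (fun _ => set0), (fun _ _ => 0), (fun _ _ => 0); split=> //; try by case.
by move=> a; rewrite big_ord0 subr0 mul1r.
Qed.

(* Leibniz doubles the number of terms; the normal directions of the variety add [c]. *)
Lemma stage_decompS (i0 : 'I_k) (J : finType) : i0 != last ->
  stage_decomp i0 J -> stage_decomp i0.+1 (J + J + 'I_c)%type.
Proof.
move=> il [N [S [p [q [S0 dep_p dep_q dec]]]]].
(* Choosing [mu] as a function of the polynomial, not of the multi-index, lets [mu (h a)] depend
   only on the indices on which [h a] does. Outside [I] the value 0 is a filler. *)
have /functional_choice [mu muP] : forall h, exists mu : 'I_c -> {mpoly F[n]},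
    I h -> forall j, I (delta * mderiv j h - \sum_i mu i * mderiv j (g i)).
  move=> h; case: (classic (I h)) => [/frame [mu Hmu]|nIh]; first by exists mu.
  by exists (fun _ => 0).
pose v (a : tidx k d) := Ordinal (block_lt il (ltn_ord (a i0))).
pose h a := delta ^+ N * partial T k_gt0 i0 a - \sum_t p t a * q t a.
have va (a b : tidx k d) : a i0 = b i0 -> v a = v b by move=> ab; apply: val_inj; rewrite /= ab.
have stageS : stage k_gt0 i0 \subset stage k_gt0 i0.+1.
  by apply/subsetP => i; rewrite !inE => /orP [/ltnW|->]; rewrite ?orbT // ltnS => ->.
have i0S : i0 \in stage k_gt0 i0.+1 by rewrite inE ltnS leqnn.
have i0nS : i0 \notin stage k_gt0 i0 by rewrite inE ltnn (negPf il).
have stage_ne i : i \in stage k_gt0 i0 -> i != i0.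
  by apply: contraTneq => ->.
have hdep : depends_only (stage k_gt0 i0) h.
  move=> a b ab; rewrite /h (partial_depends _ ab); congr (_ - _).
  apply: eq_bigr => t _; congr (_ * _).
    by apply: dep_p => j; rewrite inE => /andP [_ /ab].
  by apply: dep_q => j; rewrite inE => /andP [_ /ab].
(* Differentiating [p] puts [i0] into [S t], differentiating [q] puts it into the complement, and
   the normal terms split off [i0] alone. The term with the derivative of [delta ^+ N] is rewritten
   modulo [I] through the [p * q] and absorbed into the first family. *)
exists N.+1,
  (fun t => match t with inl (inl t) => S t :|: [set i0] | inl (inr t) => S t :\ i0
                       | inr _ => [set i0] end),
  (fun t a => match t with
     | inl (inl t) => delta * mderiv (v a) (p t a) - N%:R * mderiv (v a) delta * p t a
     | inl (inr t) => p t a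
     | inr l => mderiv (v a) (g l) end),
  (fun t a => match t with
     | inl (inl t) => q t a
     | inl (inr t) => delta * mderiv (v a) (q t a)
     | inr l => mu (h a) l end).
have ne_sub (A B : {set 'I_k}) : A \subset B -> A != set0 -> B != set0.
  by move=> AB; apply: contra_neq => B0; apply/eqP; rewrite -subset0 -B0.
split.
- case=> [[t|t]|l]; try have [St0 nSt0] := S0 t.
  + split; [move: St0|move: nSt0]; apply: ne_sub; apply/subsetP => i;
      rewrite !inE => /andP [iS iU]; have := stage_ne i; rewrite inE => /(_ iU) ii0;
      move: (subsetP stageS i); rewrite !inE => /(_ iU) ->; rewrite andbT.
    * by rewrite iS.
    * by rewrite negb_or iS.
  + split; [move: St0|move: nSt0]; apply: ne_sub; apply/subsetP => i;
      rewrite !inE => /andP [iS iU]; have := stage_ne i; rewrite inE => /(_ iU) ii0;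
      move: (subsetP stageS i); rewrite !inE => /(_ iU) ->; rewrite andbT.
    * by rewrite iS ii0.
    * by rewrite negb_and iS orbT.
  + split; apply/set0Pn; first by exists i0; rewrite inE set11.
    by exists last; rewrite !inE eqxx orbT andbT eq_sym.
- case=> [[t|t]|l] a b ab.
  + have -> : p t a = p t b.
      apply: dep_p => i; rewrite inE => /andP [iS iU]; apply: ab.
      by rewrite !inE iS; move: (subsetP stageS i iU); rewrite inE.
    by have -> : v a = v b by apply/va/ab; rewrite !inE eqxx orbT ltnS leqnn.
  + apply: dep_p => i; rewrite inE => /andP [iS iU]; apply: ab.
    by rewrite !inE iS stage_ne //; move: (subsetP stageS i iU); rewrite inE.
  + by have -> : v a = v b by apply/va/ab; rewrite !inE eqxx ltnS leqnn.
- case=> [[t|t]|l] a b ab.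
  + apply: dep_q => i; rewrite inE => /andP [iS iU]; apply: ab.
    move: iS; rewrite !inE negb_or stage_ne // => ->.
    by move: (subsetP stageS i iU); rewrite inE.
  + have -> : q t a = q t b.
      apply: dep_q => i; rewrite inE => /andP [iS iU]; apply: ab.
      move: iS; rewrite !inE negb_and => ->; rewrite orbT.
      by move: (subsetP stageS i iU); rewrite inE.
    by have -> : v a = v b by apply/va/ab; rewrite !inE eqxx ltnS leqnn.
  + have -> // : h a = h b.
    apply: hdep => i iU; apply: ab; rewrite !inE stage_ne //.
    by move: (subsetP stageS i iU); rewrite inE.
move=> a; rewrite !big_sumType /=.
have Ih : I (h a) by exact: dec.
(* Subtracting this multiple of [h a] cancels the term in which [delta ^+ N] was differentiated. *)
have := primeB primeI (muP _ Ih (v a)) (primeMl primeI (N%:R * mderiv (v a) delta) Ih).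
congr I.
set E := partial T k_gt0 i0.+1 a; set P := partial T k_gt0 i0 a.
pose S1 := \sum_t mderiv (v a) (p t a) * q t a.
pose S2 := \sum_t p t a * mderiv (v a) (q t a).
pose S3 := \sum_t p t a * q t a.
have Dh : mderiv (v a) (h a) =
    mderiv (v a) (delta ^+ N) * P + delta ^+ N * E - (S1 + S2).
  rewrite /h mderivB mderivM mderiv_partial (raddf_sum (mderiv (v a))) /=.
  congr (_ - _); rewrite /S1 /S2 -big_split /=.
  by apply: eq_bigr => t _; rewrite mderivM.
have -> : \sum_t (delta * mderiv (v a) (p t a) - N%:R * mderiv (v a) delta * p t a) * q t a
    = delta * S1 - N%:R * mderiv (v a) delta * S3.
  rewrite /S1 /S3 !mulr_sumr -sumrB; apply: eq_bigr => t _; ring.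
have -> : \sum_t p t a * (delta * mderiv (v a) (q t a)) = delta * S2.
  by rewrite /S2 mulr_sumr; apply: eq_bigr => t _; ring.
have -> : \sum_l mderiv (v a) (g l) * mu (h a) l = \sum_i mu (h a) i * mderiv (v a) (g i).
  by apply: eq_bigr => t _; exact: mulrC.
rewrite Dh mulrBr mulrDr mulrA mderiv_exp {2}/h -/P -/S3 exprS.
set X := \sum_(i < c) _; ring.
Qed.

(** The count follows from [2 (2^j - 1) c + c = (2^(j+1) - 1) c]. After [k - 1] steps the stage is
    the whole index set and the derivative is the constant [T a]; evaluation at [a0], where [delta]
    is invertible, gives the decomposition. *)
Lemma partition_rank_iteration : partition_rank_le T ((2 ^ k.-1 - 1) * c).
Proof.
have stages j : (j <= k.-1)%N ->
    exists2 J : finType, #|J| = ((2 ^ j - 1) * c)%N & stage_decomp j J.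
  elim: j => [_|j IH jk].
    by exists 'I_0; [rewrite card_ord | exact: stage_decomp0].
  have [J cardJ decJ] := IH (ltnW jk).
  have jk' : (j < k)%N by rewrite (leq_trans jk) // leq_pred.
  have il : Ordinal jk' != last by rewrite -val_eqE /= neq_ltn jk.
  exists (J + J + 'I_c)%type; last exact: (stage_decompS il decJ).
  rewrite !card_sum card_ord cardJ expnS.
  have := expn_gt0 2 j; move: (2 ^ j)%N => e; case: e => // e _.
  by rewrite mul2n -addnn !addSn !addnS !subSS !subn0; ring.
have [J cardJ [N [S [p [q [S0 dep_p dep_q dec]]]]]] := stages _ (leqnn _).
exists #|J|; first by rewrite cardJ.
have stageT : stage k_gt0 k.-1 = setT.
  by apply/setP => i; rewrite !inE -val_eqE /= orbC -leq_eqVlt -ltnS prednK ?ltn_ord.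
rewrite stageT in S0 dep_p dep_q.
exists (fun t => S (enum_val t)),
  (fun t a => (delta.@[a0] ^+ N)^-1 * (p (enum_val t) a).@[a0]),
  (fun t a => (q (enum_val t) a).@[a0]); split.
- move=> t; have [] := S0 (enum_val t); rewrite !setIT => -> nS0; split=> //.
  by apply: contra_neq nS0 => ->; rewrite setCT.
- by move=> t a b ab; rewrite (dep_p _ a b) // => j; rewrite setIT; exact: ab.
- by move=> t a b ab; rewrite (dep_q _ a b) // => j; rewrite setIT; exact: ab.
move=> a; have := I_a0 (dec a); rewrite partial_last mevalB mevalM mevalC.
rewrite (rmorphXn (meval a0)) (rmorph_sum (meval a0)) /= => /eqP; rewrite subr_eq0 => /eqP E.
have dN : delta.@[a0] ^+ N != 0 by rewrite expf_neq0.
rewrite -[LHS](mulKf dN) E mulr_sumr.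
rewrite (reindex_onto (@enum_val J _) enum_rank) /=; last by move=> t _; exact: enum_rankK.
apply: eq_big => [t|t _]; first by rewrite enum_valK eqxx.
by rewrite mevalM mulrA.
Qed.

End Iteration.

Theorem theorem6p1 (F : fieldType) (K : closedFieldType)
  (iota : {rmorphism F -> K}) (k : nat) (d : nat -> nat) (T : tidx k d -> F)
  (X : ('I_(nvars k d) -> K) -> Prop) (dX : nat) (x0 : 'I_(nvars k d) -> K) :
  perfect_field F -> is_alg_closure iota -> (2 <= k)%N ->
  (* X is contained in ker Tbar *)
  (forall x, X x -> forall c, (slicing iota T c).@[x] = 0) ->
  irreducible_var X -> defined_over iota X ->
  var_dim X dX ->
  (* x0 : an F-rational point of X, non-singular and not D Tbar-singular *)
  X x0 -> rational_point iota x0 ->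
  subspace_dim (tangent_space X x0) dX ->
  (forall y, X y -> (\rank (jacobian iota T y) <= \rank (jacobian iota T x0))%N) ->
  partition_rank_le T ((2 ^ k.-1 - 1) * (nvars k d - dX))%N.
Proof.
move=> perfF algK k2 kerX irrX defX [chainX _] Xx0 [a Ea] tanX _.
have Ex0 : x0 = fun i => iota (a i) by apply: functional_extensionality.
rewrite {}Ex0 in Xx0 tanX.
have k_gt0 : (0 < k)%N by exact: leq_trans k2.
have [delta [g [delta_a frame]]] :=
  exists_normal_frame perfF algK irrX defX chainX tanX.
apply: (partition_rank_iteration (k_gt0 := k_gt0) (rational_vanishing_prime iota irrX)
  (rational_vanishing_eval Xx0) delta_a frame) => b.
by rewrite /rational_vanishing partial0 => x Xx; exact: kerX.
Qed.
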